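(* Let $1\leq k_1<\cdots<k_s$ be integers and let $r=\lfloor\log_2(k_s)\rfloor+1$. Let $j_1,\ldots,j_t$ be all the integers $j$ in $\{0,1,\ldots,2^r-1\}$ with the property that $$\binom{j}{k_1}+\cdots+\binom{j}{k_s}$$ is odd. Then there is at least one odd prime $p$ such that $p\mid S(\sigma_{p,[k_1,\ldots,k_s]})$ if and only if at least one of the integers $j_1,\ldots,j_t$ is odd. Moreover, if $j_{o_1},\ldots,j_{o_f}$ are the odd integers among $j_1,\ldots,j_t$, then the odd primes $p$ with the property $p\mid S(\sigma_{p,[k_1,\ldots,k_s]})$ are precisely the primes in the arithmetic progressions $$j_{o_1}+m\cdot 2^r,\ \ldots,\ j_{o_f}+m\cdot 2^r\qquad (m\ge 0).$$
   Context: For integers $1\leq k_1<\cdots<k_s$ and $n\geq 1$, $$S(\sigma_{n,[k_1,\ldots,k_s]})=\sum_{j=0}^n(-1)^{\binom{j}{k_1}+\cdots+\binom{j}{k_s}}\binom{n}{j}.$$ $S(\sigma_{p,[k_1,\ldots,k_s]})$ denotes the term of this sequence with $n=p$. *)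

(* Defs.v *)
From mathcomp Require Import all_boot all_order all_algebra.

Set Implicit Arguments.
Unset Strict Implicit.
Unset Printing Implicit Defensive.

Import GRing.Theory Num.Theory.

Definition binsum (ks : seq nat) (j : nat) : nat := \sum_(k <- ks) 'C(j, k).

(* The integer S(sigma_{n,[k_1,...,k_s]}), with ks = [:: k_1; ...; k_s].
   The bound n.+1 makes j range over 0, ..., n inclusive. *)
Definition expsum (n : nat) (ks : seq nat) : int :=
  (\sum_(j < n.+1) (-1) ^+ binsum ks j * ('C(n, j))%:Z)%R.

(* r = floor(log_2 k_s) + 1, where k_s is the last (largest) entry of ks. *)
Definition period_exp (ks : seq nat) : nat := trunc_log 2 (last 0 ks) + 1.

(* The list j_1, ..., j_t. *)
Definition odd_indices (ks : seq nat) : seq nat :=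
  [seq j <- iota 0 (2 ^ period_exp ks) | odd (binsum ks j)].

(* Main.v *)
Require Import Defs.
From mathcomp Require Import all_boot all_order all_algebra.
From mathcomp Require Import all_fingroup all_solvable all_field all_character.
From mathcomp Require Import reals exp complex Rstruct.
From mathcomp Require Import zify ring lra.

(** Modulo an odd prime p every binomial coefficient C(p, j) with 0 < j < p
vanishes, so the exponential sum reduces to its two end terms,
1 + (-1) ^ binsum ks p, and p divides it exactly when binsum ks p is odd
[prime_dvd_expsum].  Since C(2^r, i) is even for 0 < i < 2^r, the parity of
C(j, k) with k < 2^r has period 2^r in j, hence so has the parity of
binsum ks [odd_binsum_mod].  This gives the description of the primes by
arithmetic progressions.

What remains is that every progression j + m 2^r with j odd contains a prime,
which is Dirichlet's theorem for the modulus 2^r [prime_in_odd_class].  It is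
proved along the elementary lines of Mertens and Shapiro, with finite sums
only.  Write T(chi, N) for the sum of chi(n) Lambda(n) / n over n <= N, where
Lambda is the von Mangoldt function, and L(chi) for the value at 1 of the
L-function of a character chi.  Up to a bounded error, T(chi, N) is

- ln N for the principal character [principal_wsum], by the estimates of
  Chebyshev [psi_le] and Mertens [sum_mangoldt_over_le, sum_mangoldt_over_ge];
- 0 if L(chi) <> 0 [wsum_mangoldt_bounded];
- - ln N if L(chi) = 0 [wsum_mangoldt_zero].

The sum of T(chi, N) over all characters is nonnegative, because only the
n = 1 modulo q survive in it; so L vanishes for at most one character
[at_most_one_zero].  The conjugate of a zero is a zero, hence that character
would be real.  But modulo 2^r an integer which is 1 modulo 8 is a square
[square_mod_pow2], so a real character only depends on its argument modulo 8,
and grouping the series of L by blocks of eight terms shows L > 0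
[real_lvalue_neq0].  By orthogonality the sum of Lambda(n) / n over n <= N in
a class prime to q is therefore ln N / #characters + O(1).  Prime powers that
are not primes contribute a bounded amount [sum_mangoldt_nonprime], so the
class contains a prime [prime_in_inverse_class]. *)

Set Implicit Arguments.
Unset Strict Implicit.
Unset Printing Implicit Defensive.

Import Order.TTheory GRing.Theory Num.Theory.

(** * Sums over divisors *)

Section DivisorSums.
Local Open Scope ring_scope.
Variable V : zmodType.

Lemma sum_multiples (N d : nat) (F : nat -> V) : (0 < d)%N ->
  \sum_(1 <= n < N.+1 | (d %| n)%N) F n =
  \sum_(1 <= m < (N %/ d).+1) F (d * m)%N.
Proof.
move=> d0; elim: N => [|N IH]; first by rewrite div0n !big_geq.
rewrite big_mkcond big_nat_recr //= -big_mkcond IH divnS //.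
case: (d %| N.+1)%N / idP => dN; last by rewrite addr0 add0n.
rewrite add1n [RHS]big_nat_recr //=; congr (_ + F _).
by rewrite -[N.+1 in LHS](divnK dN) mulnC divnS // dN add1n.
Qed.

(** Both sides run over the pairs (d, m) with d * m <= N. *)
Lemma sum_over_divisor_pairs (N : nat) (F : nat -> nat -> V) :
  \sum_(1 <= n < N.+1) \sum_(1 <= d < n.+1 | (d %| n)%N) F d (n %/ d)%N =
  \sum_(1 <= d < N.+1) \sum_(1 <= m < (N %/ d).+1) F d m.
Proof.
have -> : \sum_(1 <= n < N.+1) \sum_(1 <= d < n.+1 | (d %| n)%N) F d (n %/ d)%N
  = \sum_(1 <= n < N.+1) \sum_(1 <= d < N.+1 | (d %| n)%N) F d (n %/ d)%N.
  apply: eq_big_nat => n /andP[n1 nN].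
  rewrite (big_nat_widen 1 n.+1 N.+1) //; apply: eq_bigl => d.
  by case: (boolP (d %| n)%N) => // /(dvdn_leq n1); rewrite ltnS => ->.
rewrite (exchange_big_dep_nat xpredT) //=.
apply: eq_big_nat => d /andP[d1 _].
rewrite (sum_multiples N (fun n => F d (n %/ d)%N)) //.
by apply: eq_bigr => m _; rewrite mulKn.
Qed.

End DivisorSums.

(** * The functions of Moebius and von Mangoldt *)

Section Mobius.
Local Open Scope ring_scope.

Definition mobius (n : nat) : int :=
  if all (fun p => logn p n == 1%N) (primes n)
  then (-1) ^+ size (primes n) else 0.

Lemma norm_mobius (n : nat) : `|mobius n| <= 1.
Proof. by rewrite /mobius; case: ifP => // _; rewrite normrX normrN1 expr1n. Qed.

Lemma mobius_prime_mul (p e : nat) : prime p -> (0 < e)%N ->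
  mobius (p * e) = if (p %| e)%N then 0 else - mobius e.
Proof.
move=> pp e0; have p0 := prime_gt0 pp.
rewrite /mobius; case: (boolP (p %| e)%N) => pe.
  case: allP => // /(_ p).
  have pin: p \in primes (p * e) by rewrite mem_primes pp muln_gt0 p0 e0 dvdn_mulr.
  move=> /(_ pin); rewrite lognM // (logn_prime _ pp) eqxx add1n eqSS.
  by rewrite eqn0Ngt logn_gt0 mem_primes pp e0 pe.
have pr : perm_eq (primes (p * e)) (p :: primes e).
  apply: uniq_perm; rewrite ?primes_uniq //= ?primes_uniq ?andbT.
    by rewrite mem_primes pp e0 (negbTE pe).
  by move=> x; rewrite primesM // inE (primes_prime pp) inE.
rewrite (perm_all _ pr) (perm_size pr) /=.
rewrite lognM // (logn_prime _ pp) eqxx.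
have -> : logn p e = 0%N by apply/eqP; rewrite eqn0Ngt logn_gt0 mem_primes pp e0.
rewrite eqxx /=.
have -> : all (fun q => logn q (p * e) == 1%N) (primes e)
   = all (fun q => logn q e == 1%N) (primes e).
  apply: eq_in_all => r; rewrite mem_primes => /and3P[rp _ re].
  rewrite lognM // (logn_prime _ pp) (_ : (r == p) = false) //.
  by apply: contraNF pe => /eqP <-.
by case: ifP => _; rewrite ?oppr0 // exprS mulN1r.
Qed.

(** For a prime p dividing n, the divisors prime to p cancel against their
multiples by p, and mobius vanishes on the remaining divisors. *)
Lemma sum_mobius (n : nat) : (0 < n)%N ->
  \sum_(1 <= d < n.+1 | (d %| n)%N) mobius d = (n == 1%N)%:R.
Proof.
move=> n0; case: eqP => [->|/eqP n1]; first by rewrite big_mkcond big_nat1.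
have n2 : (1 < n)%N by rewrite ltn_neqAle eq_sym n1.
have pp := pdiv_prime n2; set p := pdiv n in pp.
have /dvdnP[m nE] : (p %| n)%N by apply: pdiv_dvd.
have p0 := prime_gt0 pp.
have m0 : (0 < m)%N by move: n0; rewrite nE muln_gt0 => /andP[].
rewrite (bigID (fun d => p %| d)%N) /=.
have -> : \sum_(1 <= d < n.+1 | (d %| n)%N && (p %| d)%N) mobius d
  = - \sum_(1 <= d < m.+1 | (d %| m)%N && ~~ (p %| d)%N) mobius d.
  under eq_bigl do rewrite andbC.
  pose F d := if (d %| n)%N then mobius d else 0.
  rewrite big_mkcondr /= (sum_multiples n F) // /F.
  rewrite {1}nE mulnK // -sumrN [RHS]big_mkcond; apply: eq_big_nat => e /andP[e1 _].
  rewrite nE mulnC dvdn_pmul2r // mulnC mobius_prime_mul //.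
  by case: (e %| m)%N => //=; case: (p %| e)%N.
rewrite addrC; apply/eqP; rewrite subr_eq0; apply/eqP.
rewrite (big_nat_widen 1 m.+1 n.+1) ?ltnS ?nE ?leq_pmulr //.
apply: eq_bigl => d; case: (boolP (p %| d)%N) => pd; rewrite ?andbF //= !andbT.
rewrite Gauss_dvdl; last by rewrite coprime_sym prime_coprime.
by case: (boolP (d %| m)%N) => // /(dvdn_leq m0); rewrite ltnS => ->.
Qed.

End Mobius.

Section VonMangoldt.
Local Open Scope ring_scope.
Variable R : realType.

Definition lnn (n : nat) : R := ln n%:R.

(** The sum over all p and k makes nonnegativity evident, and turns a sum of
mangoldt over the divisors of n into a count of the prime powers dividing n. *)
Definition mangoldt (n : nat) : R :=
  \sum_(1 <= p < n.+1 | prime p) \sum_(1 <= k < n.+1 | n == (p ^ k)%N) lnn p.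

Lemma lnn1 : lnn 1 = 0. Proof. exact: ln1. Qed.

Lemma lnnM (m n : nat) : (0 < m)%N -> (0 < n)%N -> lnn (m * n) = lnn m + lnn n.
Proof. by move=> m0 n0; rewrite /lnn natrM lnM ?posrE ?ltr0n. Qed.

Lemma lnn_ge0 (n : nat) : 0 <= lnn n.
Proof.
case: n => [|n]; first by rewrite /lnn ln0.
by rewrite ln_ge0 // ler1n.
Qed.

Lemma ler_lnn (m n : nat) : (0 < m)%N -> (m <= n)%N -> lnn m <= lnn n.
Proof.
move=> m0 mn; rewrite ler_ln ?posrE ?ltr0n ?ler_nat //.
exact: leq_trans mn.
Qed.

Lemma lnnX (m k : nat) : (0 < m)%N -> lnn (m ^ k) = lnn m *+ k.
Proof. by move=> m0; rewrite /lnn natrX lnXn ?ltr0n. Qed.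

Lemma mangoldt_ge0 (n : nat) : 0 <= mangoldt n.
Proof. by apply: sumr_ge0 => p _; apply: sumr_ge0 => k _; apply: lnn_ge0. Qed.

(** A common range of summation for all n <= N, so that sums can be exchanged. *)
Lemma mangoldt_widen (N n : nat) : (n <= N)%N ->
  mangoldt n = \sum_(1 <= p < N.+1 | prime p)
                 \sum_(1 <= k < N.+1 | n == (p ^ k)%N) lnn p.
Proof.
move=> nN; rewrite /mangoldt (big_nat_widen 1 n.+1 N.+1) //.
rewrite [RHS]big_mkcond [LHS]big_mkcond; apply: eq_bigr => p _.
case: (boolP (prime p)) => //= pp; rewrite ltnS.
rewrite (big_nat_widen 1 n.+1 N.+1) //.
case: (leqP p n) => pn.
  apply: eq_bigl => k; case: eqP => // -> /=; rewrite ltnS ltnW //.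
  exact/ltn_expl/prime_gt1.
rewrite big_nat_cond big1 // => k /andP[/andP[k1 _] /eqP nE].
have : (p ^ 1 <= p ^ k)%N by rewrite leq_pexp2l // prime_gt0.
by rewrite expn1 -nE leqNgt pn.
Qed.

Lemma lnn_prod (I : Type) (s : seq I) (P : pred I) (F : I -> nat) :
  (forall i, P i -> 0 < F i)%N ->
  lnn (\prod_(i <- s | P i) F i) = \sum_(i <- s | P i) lnn (F i).
Proof.
move=> F0; elim: s => [|i s IH]; first by rewrite !big_nil lnn1.
rewrite !big_cons; case: ifP => // Pi.
by rewrite lnnM ?F0 // ?IH // prodn_cond_gt0.
Qed.

(** Each prime p has exactly logn p n powers p ^ k, k >= 1, that divide n. *)
Lemma sum_mangoldt (n : nat) : (0 < n)%N ->
  \sum_(1 <= d < n.+1 | (d %| n)%N) mangoldt d = lnn n.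
Proof.
move=> n0.
transitivity (\sum_(1 <= p < n.+1 | prime p) lnn p *+ logn p n); last first.
  rewrite -[in RHS](partnT n0).
  rewrite (@widen_partn n) // lnn_prod; last first.
    by case=> [|p] _; rewrite expn_gt0 // lognE.
  rewrite [RHS]big_ltn // lognE /= expn0 lnn1 add0r.
  rewrite big_mkcond [RHS]big_mkcond; apply: eq_big_nat => p /andP[p1 _] /=.
  rewrite lnnX //; case: ifP => // pp.
  by rewrite lognE pp mulr0n.
transitivity (\sum_(1 <= d < n.+1 | (d %| n)%N) \sum_(1 <= p < n.+1 | prime p)
                 \sum_(1 <= k < n.+1 | d == (p ^ k)%N) lnn p).
  rewrite big_nat_cond [RHS]big_nat_cond.
  by apply: eq_bigr => d /andP[/andP[_ dn] _]; rewrite (@mangoldt_widen n).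
rewrite exchange_big /= big_nat_cond [RHS]big_nat_cond.
apply: eq_bigr => p /andP[/andP[p1 _] pp].
rewrite (exchange_big_dep_nat xpredT) //=.
transitivity (\sum_(1 <= k < n.+1 | (k < (logn p n).+1)%N) lnn p).
  rewrite [RHS]big_mkcond; apply: eq_big_nat => k /andP[k1 _].
  rewrite ltnS -pfactor_dvdn //; case: ifP => pk.
    rewrite (eq_bigl (fun d => d == p ^ k)%N); last first.
      by move=> d /=; case: eqP => [->|_]; rewrite ?pk ?andbF.
    by rewrite big_nat1_eq expn_gt0 p1 ltnS dvdn_leq.
  by rewrite big1 // => d /andP[dn /eqP dE]; move: dn; rewrite dE pk.
rewrite -[RHS]/(lnn p *+ (logn p n).+1.-1) -subn1 -sumr_const_nat.
by rewrite (big_nat_widen 1 (logn p n).+1 n.+1) // ltnS ltnW // ltn_logl.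
Qed.

End VonMangoldt.

(** * Estimates of Chebyshev and Mertens *)

Section Chebyshev.
Local Open Scope ring_scope.
Variable R : realType.
Local Notation lnn := (@lnn R).
Local Notation mangoldt := (@mangoldt R).

(** Moebius inversion of [sum_mangoldt]: the sum of mobius d * ln (n / d) over
the divisors of n is mangoldt n, and the part in ln n drops out by
[sum_mobius], except for n = 1, where ln n = 0. *)
Lemma sum_mobius_lnn (n : nat) : (0 < n)%N ->
  \sum_(1 <= d < n.+1 | (d %| n)%N) (mobius d)%:~R * lnn d = - mangoldt n.
Proof.
move=> n0.
have mob m : (0 < m)%N ->
    \sum_(1 <= d < m.+1 | (d %| m)%N) (mobius d)%:~R = (m == 1%N)%:R :> R.
  by move=> m0; rewrite -rmorph_sum sum_mobius // rmorph_nat.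
have E : \sum_(1 <= d < n.+1 | (d %| n)%N) (mobius d)%:~R * lnn (n %/ d) = mangoldt n.
  transitivity (\sum_(1 <= d < n.+1) \sum_(1 <= e < n.+1 | (d * e %| n)%N)
      (mobius d)%:~R * mangoldt e).
    rewrite big_mkcond; apply: eq_big_nat => d /andP[d1 dn].
    case: ifP => dvd; last first.
      rewrite big_pred0 // => e; apply: contraFF dvd; exact/dvdn_trans/dvdn_mulr.
    have nd0 : (0 < n %/ d)%N by rewrite divn_gt0 // dvdn_leq.
    rewrite -big_distrr /= -(sum_mangoldt R nd0).
    rewrite (big_nat_widen 1 (n %/ d).+1 n.+1) ?ltnS ?leq_div //.
    congr (_ * _); apply: eq_bigl => e; rewrite [(d * e)%N]mulnC -dvdn_divRL //.
    case: (boolP (e %| n %/ d)%N) => // edvd.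
    by rewrite ltnS dvdn_leq // divn_gt0 // dvdn_leq.
  rewrite (exchange_big_dep_nat xpredT) //=.
  transitivity (\sum_(1 <= e < n.+1) if e == n then mangoldt e else 0).
    apply: eq_big_nat => e /andP[e1 en].
    rewrite -big_distrl /=.
    case: (boolP (e %| n)%N) => dvd; last first.
      rewrite big_pred0 ?mul0r; last first.
        by move=> d; apply: contraNF dvd; exact/dvdn_trans/dvdn_mull.
      by case: eqP dvd => // ->; rewrite dvdnn.
    have ne0 : (0 < n %/ e)%N by rewrite divn_gt0 // dvdn_leq.
    have := mob _ ne0.
    rewrite (big_nat_widen 1 (n %/ e).+1 n.+1) ?ltnS ?leq_div // => mobE.
    transitivity (((n %/ e)%N == 1%N)%:R * mangoldt e).
      rewrite -mobE; congr (_ * _); apply: eq_bigl => d; rewrite -dvdn_divRL //.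
      by case: (boolP (d %| n %/ e)%N) => // /(dvdn_leq ne0); rewrite ltnS => ->.
    have -> : ((n %/ e)%N == 1%N) = (e == n).
      by rewrite eq_sym eqn_div // mul1n.
    by case: eqP; rewrite ?mul1r ?mul0r.
  by rewrite -big_mkcond big_nat1_eq n0 ltnSn.
apply/eqP; rewrite -subr_eq0 opprK -E -big_split /=; apply/eqP.
rewrite (eq_bigr (fun d => (mobius d)%:~R * lnn n)); last first.
  move=> d dn; have d0 := dvdn_gt0 n0 dn.
  have nd0 : (0 < n %/ d)%N by rewrite divn_gt0 // dvdn_leq.
  by rewrite -mulrDr -lnnM // mulnC divnK.
rewrite -big_distrl /= mob //.
by case: eqP => [->|]; rewrite ?lnn1 ?mulr0 ?mul0r.
Qed.

Definition psi (N : nat) : R := \sum_(1 <= n < N.+1) mangoldt n.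

Lemma lnn_fact (N : nat) : lnn N`! = \sum_(1 <= m < N.+1) lnn m.
Proof.
rewrite fact_prod big_nat_cond lnn_prod; last by move=> i /andP[/andP[]].
by rewrite -big_nat_cond.
Qed.

(** Legendre's formula: N %/ d counts the multiples of d up to N. *)
Lemma sum_mangoldt_div (N : nat) :
  \sum_(1 <= d < N.+1) mangoldt d * (N %/ d)%:R = lnn N`!.
Proof.
rewrite lnn_fact.
transitivity (\sum_(1 <= n < N.+1) \sum_(1 <= d < n.+1 | (d %| n)%N) mangoldt d).
  by rewrite (sum_over_divisor_pairs N (fun d _ => mangoldt d));
     apply: eq_bigr => d _; rewrite sumr_const_nat subn1 mulr_natr.
by apply: eq_big_nat => n /andP[n1 _]; rewrite sum_mangoldt.
Qed.

Lemma bin_le_exp2 (n k : nat) : ('C(n, k) <= 2 ^ n)%N.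
Proof.
elim: n k => [|n IH] [|k] //; first by rewrite bin0 expn_gt0.
by rewrite binS expnS mul2n -addnn leq_add.
Qed.

Lemma ln2_le1 : lnn 2 <= 1.
Proof. by rewrite /lnn -[2%:R]/(1 + 1 : R) le_ln1Dx //; lra. Qed.

(** The logarithm of C(2N, N) is the sum of
mangoldt d * (2N %/ d - 2 (N %/ d)), where every coefficient is nonnegative
and those with N < d <= 2N are at least 1; on the other hand C(2N, N) is at
most 2 ^ (2N), and ln 2 <= 1. *)
Lemma psi_double (N : nat) : psi (2 * N) <= psi N + (2 * N)%:R.
Proof.
have binb : lnn (2 * N)`! <= lnn N`! + lnn N`! + (2 * N)%:R.
  have -> : ((2 * N)`! = 'C(2 * N, N) * (N`! * N`!))%N.
    by rewrite -[LHS](@bin_fact (2 * N) N) ?leq_pmull // mul2n -addnn addnK.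
  have C0 : (0 < 'C(2 * N, N))%N by rewrite bin_gt0 leq_pmull.
  rewrite !lnnM ?muln_gt0 ?fact_gt0 // addrC lerD2l.
  apply: le_trans (ler_lnn _ C0 (bin_le_exp2 _ _)) _.
  rewrite lnnX // -[leRHS]mulr_natl mulr1 -[leLHS]mulr_natl.
  by rewrite -[leRHS]mulr1 ler_wpM2l // ln2_le1.
have E : psi (2 * N) = psi N + \sum_(N.+1 <= n < (2 * N).+1) mangoldt n.
  by rewrite /psi (@big_cat_nat _ _ _ N.+1) //= ltnS leq_pmull.
rewrite E lerD2l.
have : lnn (2 * N)`! - (lnn N`! + lnn N`!) >= \sum_(N.+1 <= n < (2 * N).+1) mangoldt n.
  rewrite -!sum_mangoldt_div.
  rewrite (@big_cat_nat _ _ _ N.+1 1 (2 * N).+1) //=; last by rewrite ltnS leq_pmull.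
  rewrite addrAC -big_split /= -sumrB -[leLHS]add0r; apply: lerD.
    apply: sumr_ge0 => d _; rewrite -mulrDr -mulrBr mulr_ge0 ?mangoldt_ge0 //.
    rewrite -natrD subr_ge0 ler_nat.
    case: d => [|d]; first by rewrite !divn0.
    by rewrite addnn -mul2n leq_divRL // -mulnA leq_pmul2l // leq_divM.
  apply: ler_sum_nat => d /andP[d1 d2].
  rewrite ler_peMr ?mangoldt_ge0 // ler1n divn_gt0 //.
  exact: leq_trans d1.
lra.
Qed.

(** Iterating [psi_double] gives psi (2 ^ k) <= 2 * 2 ^ k; the next power of 2
above N is at most 2 N. *)
Lemma psi_le (N : nat) : psi N <= 4 * N%:R.
Proof.
case: N => [|N]; first by rewrite /psi big_geq // mulr0.
have pow k : psi (2 ^ k) <= 2 * (2 ^ k)%:R.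
  elim: k => [|k IH].
    rewrite /psi big_nat1 /mangoldt big_nat_cond big1 ?mulr1 //.
    by case=> [|[|p]] // /andP[].
  rewrite expnS; apply: le_trans (psi_double _) _.
  rewrite natrM; lra.
have [k Nk kN] : exists2 k, (N.+1 <= 2 ^ k)%N & (2 ^ k <= 2 * N.+1)%N.
  (* N stands for the predecessor of the argument, so that the power strictly
     above N is the one wanted. *)
  exists (trunc_log 2 N).+1; first by rewrite trunc_log_ltn.
  rewrite expnS leq_pmul2l //.
  case: (posnP N) => [->|N0]; first by rewrite trunc_log0.
  by rewrite (leq_trans (trunc_logP _ N0)).
apply: (@le_trans _ _ (psi (2 ^ k))).
  rewrite /psi (@big_cat_nat _ _ _ N.+2 1 (2 ^ k).+1) //= lerDl.
  by apply: sumr_ge0 => i _; apply: mangoldt_ge0.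
apply: le_trans (pow k) _.
have : (2 ^ k)%:R <= (2 * N.+1)%:R :> R by rewrite ler_nat.
rewrite natrM; lra.
Qed.

Lemma lnn_step (N : nat) : (0 < N)%N -> lnn N.+1 - lnn N <= N%:R^-1.
Proof.
move=> N0; have N0' : 0 < N%:R :> R by rewrite ltr0n.
rewrite /lnn -ln_div ?posrE ?ltr0n //.
have -> : N.+1%:R / N%:R = 1 + N%:R^-1 :> R.
  by rewrite -natr1 mulrDl divff ?gt_eqF // mul1r.
by rewrite le_ln1Dx // (lt_le_trans (ltrN10 R)) // invr_ge0 ltW.
Qed.

Lemma lnn_fact_ge (N : nat) : N%:R * lnn N - N%:R <= lnn N`!.
Proof.
elim: N => [|N IH]; first by rewrite mul0r subrr lnn_ge0.
rewrite factS lnnM ?fact_gt0 //.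
case: N IH => [|N] IH; first by rewrite lnn1 mulr0 addr0 add0r lerN10.
have := @lnn_step N.+1 isT; rewrite -(ler_pM2l (ltr0Sn R N)) divff ?pnatr_eq0 //.
move: IH; rewrite -(natr1 N.+1); move: (lnn N.+2) (lnn N.+1) (lnn N.+1`!) (N.+1%:R).
move=> a b c n; nra.
Qed.

(** In [sum_mangoldt_div], replacing N %/ d by N / d costs at most psi N. *)
Lemma sum_mangoldt_over_le (N : nat) : (0 < N)%N ->
  \sum_(1 <= d < N.+1) mangoldt d / d%:R <= lnn N + 4.
Proof.
move=> N0; have N0' : 0 < N%:R :> R by rewrite ltr0n.
rewrite -(ler_pM2l N0') big_distrr /=.
apply: (@le_trans _ _ (lnn N`! + psi N)).
  rewrite -sum_mangoldt_div /psi -big_split /=.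
  apply: ler_sum_nat => d /andP[d1 _].
  rewrite -[X in _ + X]mulr1 -mulrDr mulrCA ler_wpM2l ?mangoldt_ge0 //.
  rewrite ler_pdivrMr ?ltr0n // natr1 -natrM ler_nat ltnW //.
  exact: ltn_ceil.
rewrite mulrDr lerD //; last by rewrite mulrC psi_le.
rewrite lnn_fact.
apply: (@le_trans _ _ (\sum_(1 <= m < N.+1) lnn N)).
  by apply: ler_sum_nat => m /andP[m1 mN]; rewrite ler_lnn.
by rewrite sumr_const_nat subn1 /= mulr_natl.
Qed.

(** Here N %/ d <= N / d goes in the right direction, and Stirling's lower bound
[lnn_fact_ge] concludes. *)
Lemma sum_mangoldt_over_ge (N : nat) : (0 < N)%N ->
  lnn N - 1 <= \sum_(1 <= d < N.+1) mangoldt d / d%:R.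
Proof.
move=> N0; have N0' : 0 < N%:R :> R by rewrite ltr0n.
rewrite -(ler_pM2l N0') big_distrr /= mulrBr mulr1.
apply: le_trans (lnn_fact_ge N) _; rewrite -sum_mangoldt_div.
apply: ler_sum_nat => d /andP[d1 _].
rewrite mulrCA ler_wpM2l ?mangoldt_ge0 //.
by rewrite ler_pdivlMr ?ltr0n // -natrM ler_nat leq_divM.
Qed.

(** The terms are bounded by the successive differences of (2 + ln p) / p. *)
Lemma sum_lnn_over_square (N : nat) : (0 < N)%N ->
  \sum_(2 <= p < N.+1) lnn p / (p * p.-1)%:R <= 2 - (2 + lnn N) / N%:R.
Proof.
elim: N => // N IH _.
case: N IH => [|N] IH; first by rewrite big_geq // lnn1 invr1 mulr1 addr0 subrr.
rewrite big_nat_recr //=; apply: le_trans (lerD (IH isT) (lexx _)) _.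
have := @lnn_step N.+1 isT; rewrite natrM -(natr1 N.+1).
have := ltr0Sn R N; have : 1 <= N.+1%:R :> R by rewrite ler1n.
move: (lnn N.+2) (lnn N.+1) (N.+1%:R) => a b n n1 n0 H.
have H2 : (n + 1) * (a - b) <= 2.
  apply: le_trans (ler_wpM2l _ H) _; first by lra.
  by rewrite mulrDl mul1r divff ?gt_eqF // -[leRHS]/(1 + 1) lerD2l invf_le1.
have np : 0 < n * (n + 1) by rewrite mulr_gt0 //; lra.
rewrite -subr_ge0.
have -> : 2 - (2 + a) / (n + 1) - (2 - (2 + b) / n + a / ((n + 1) * n))
   = (2 - (n + 1) * (a - b)) / (n * (n + 1)).
  by field; rewrite !gt_eqF //; lra.
by rewrite divr_ge0 ?(ltW np) // subr_ge0.
Qed.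

Lemma geometric_tail (p K : nat) : (1 < p)%N -> (1 < K)%N ->
  \sum_(2 <= k < K) (p ^ k)%:R^-1 <= (p * p.-1)%:R^-1 :> R.
Proof.
move=> p1 K1.
have [p' p'E] : exists p', p = p'.+2 by case: p p1 => [|[|p]] // _; exists p.
have strong j : \sum_(2 <= k < j.+2) (p ^ k)%:R^-1
    = (p * p.-1)%:R^-1 - (p ^ j.+1 * p.-1)%:R^-1 :> R.
  elim: j => [|j IH]; first by rewrite big_geq // subrr.
  rewrite big_nat_recr //= IH p'E /= !natrM !natrX -(natr1 p'.+1).
  have p0 := ltr0Sn R p'; move: (p'.+1%:R) p0 => x x0.
  have y0 : 0 < (x + 1) ^+ j.+1 by rewrite exprn_gt0 //; lra.
  move: ((x + 1) ^+ j.+1) y0 => y y0.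
  by field; rewrite !gt_eqF //; lra.
case: K K1 => [|[|j]] // _.
by rewrite strong gerBl invr_ge0.
Qed.

(** Only the powers p ^ k with k >= 2 contribute; for each p they form a geometric
series of sum at most ln p / (p (p - 1)). *)
Lemma sum_mangoldt_nonprime (N : nat) :
  \sum_(1 <= n < N.+1 | ~~ prime n) mangoldt n / n%:R <= 2.
Proof.
case: N => [|N]; first by rewrite big_geq.
apply: (@le_trans _ _ (\sum_(1 <= n < N.+2) \sum_(2 <= p < N.+2)
     \sum_(2 <= k < N.+2) if n == (p ^ k)%N then lnn p / (p ^ k)%:R else 0)).
  rewrite big_mkcond; apply: ler_sum_nat => n /andP[n1 nN].
  have nn : 0 <= \sum_(2 <= p < N.+2)
     \sum_(2 <= k < N.+2) if n == (p ^ k)%N then lnn p / (p ^ k)%:R else 0.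
    apply: sumr_ge0 => p _; apply: sumr_ge0 => k _; case: eqP => // _.
    by rewrite divr_ge0 // lnn_ge0.
  case: ifP => // np; rewrite (@mangoldt_widen _ N.+1) // big_distrl /=.
  rewrite big_mkcond big_ltn //= add0r; apply: ler_sum_nat => p /andP[p2 pN].
  case: ifP => pp; last first.
    apply: sumr_ge0 => k _; case: eqP => // _.
    by rewrite divr_ge0 // lnn_ge0.
  rewrite big_distrl big_mkcond big_ltn //= expn1.
  rewrite (_ : (n == p) = false) ?add0r; last first.
    by apply: contraNF np => /eqP->.
  by apply: ler_sum_nat => k _; case: eqP => // ->.
rewrite exchange_big /=.
apply: (@le_trans _ _ (\sum_(2 <= p < N.+2) lnn p / (p * p.-1)%:R)); last first.
  apply: le_trans (@sum_lnn_over_square N.+1 isT) _.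
  by rewrite gerBl divr_ge0 // addr_ge0 // lnn_ge0.
apply: ler_sum_nat => p /andP[p2 _].
rewrite exchange_big /=.
apply: (@le_trans _ _ (\sum_(2 <= k < N.+2) lnn p * (p ^ k)%:R^-1)).
  apply: ler_sum_nat => k _; rewrite -big_mkcond big_nat1_eq.
  by case: ifP => // _; rewrite mulr_ge0 ?invr_ge0 // lnn_ge0.
rewrite -big_distrr /= ler_wpM2l ?lnn_ge0 //.
exact: geometric_tail.
Qed.
End Chebyshev.

(** * Abel summation and limits with a rate *)

Section Abel.
Local Open Scope ring_scope.
Local Open Scope complex_scope.
Variable K : numDomainType.
Implicit Types f g : nat -> K.

Lemma abel_summation f g (m M : nat) : (m <= M)%N ->
  \sum_(m <= n < M) f n * g n = (\sum_(m <= n < M) f n) * g M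
    + \sum_(m <= n < M) (\sum_(m <= i < n.+1) f i) * (g n - g n.+1).
Proof.
move=> mM; rewrite -(subnKC mM); elim: (M - m)%N => [|k IH].
  by rewrite addn0 !big_geq // mul0r addr0.
rewrite addnS !(big_nat_recr (m + k)) ?leq_addr //= IH.
ring.
Qed.

(** Dirichlet's test in a quantitative form. *)
Lemma abel_bound f g (m M : nat) (B : K) :
  (forall j, `|\sum_(m <= n < j) f n| <= B) ->
  (forall n, (m <= n)%N -> 0 <= g n) ->
  (forall n, (m <= n)%N -> g n.+1 <= g n) ->
  `|\sum_(m <= n < M) f n * g n| <= B * g m.
Proof.
move=> fB g0 gdec.
have B0 : 0 <= B by apply: le_trans (fB 0%N).
case: (leqP m M) => mM; last first.
  by rewrite big_geq ?normr0 ?mulr_ge0 ?g0 // ltnW.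
rewrite abel_summation //.
have -> : B * g m = B * g M + \sum_(m <= n < M) B * (g n - g n.+1).
  rewrite -big_distrr /= -mulrDr; congr (_ * _).
  by rewrite (telescope_sumr_eq (fun n => - g n)) // => [|n _]; ring.
apply: le_trans (ler_normD _ _) _; apply: lerD.
  by rewrite normrM (ger0_norm (g0 _ mM)) ler_wpM2r ?g0.
apply: le_trans (ler_norm_sum _ _ _) _.
apply: ler_sum_nat => n /andP[mn _].
have gn : 0 <= g n - g n.+1 by rewrite subr_ge0 gdec.
by rewrite normrM (ger0_norm gn) ler_wpM2r.
Qed.

Lemma sum_shifted_period f (q : nat) : (forall n, f (n + q)%N = f n) ->
  forall m, \sum_(m <= n < m + q) f n = \sum_(0 <= n < q) f n.
Proof.
move=> per; elim=> [|m IH] //; rewrite -IH.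
case: q per {IH} => [|q] per; first by rewrite !big_geq ?addn0.
rewrite addSn big_nat_recr ?leq_addr //=; last by rewrite addnS ltnS leq_addr.
by rewrite per addrC [RHS]big_ltn // addnS ltnS leq_addr.
Qed.

(** Whole periods contribute nothing, and less than one period is left over. *)
Lemma periodic_sum_bound f (q : nat) : (0 < q)%N ->
  (forall n, f (n + q)%N = f n) -> \sum_(0 <= n < q) f n = 0 ->
  (forall n, `|f n| <= 1) ->
  forall m M, `|\sum_(m <= n < M) f n| <= q%:R.
Proof.
move=> q0 per f0 f1 m M.
have [k] := ubnP (M - m)%N; elim: k m => // k IH m; rewrite ltnS => Mk.
case: (leqP (M - m) q) => Mq.
  apply: le_trans (ler_norm_sum _ _ _) _.
  apply: (@le_trans _ _ (\sum_(m <= n < M) 1)); first exact: ler_sum.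
  by rewrite sumr_const_nat ler_nat.
rewrite (@big_cat_nat _ _ _ (m + q)) ?leq_addr //=; last by lia.
rewrite sum_shifted_period // f0 add0r IH //; lia.
Qed.

End Abel.

Section Limits.
Local Open Scope ring_scope.
Local Open Scope complex_scope.
Variable R : realType.

(** The intervals of centre u n and radius c / (n + 1) meet pairwise, so the
supremum of their lower ends lies in all of them. *)
Lemma real_limit_rate (u : nat -> R) (c : R) :
  (forall n m, (n <= m)%N -> `|u m - u n| <= c / n.+1%:R) ->
  exists l, forall n, `|u n - l| <= c / n.+1%:R.
Proof.
move=> cau.
pose E : classical_sets.set R := fun x => exists n, x = u n - c / n.+1%:R.
have ubE m : classical_sets.ubound E (u m + c / m.+1%:R).
  move=> x [n ->]; case/orP: (leq_total n m) => nm.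
  - have := cau _ _ nm; rewrite ler_norml => /andP[H1 H2].
    have : 0 <= c / m.+1%:R by apply: le_trans (cau _ _ (leqnn m)).
    move: (c / m.+1%:R) (c / n.+1%:R) (u m) (u n) H1 H2 => *; lra.
  - have := cau _ _ nm; rewrite ler_norml => /andP[H1 H2].
    have : 0 <= c / n.+1%:R by apply: le_trans (cau _ _ (leqnn n)).
    move: (c / m.+1%:R) (c / n.+1%:R) (u m) (u n) H1 H2 => *; lra.
exists (sup E) => n; rewrite ler_norml.
have H1 : u n - c / n.+1%:R <= sup E.
  by apply: ub_le_sup; [exists (u 0%N + c / 1%:R) | exists n].
have H2 : sup E <= u n + c / n.+1%:R.
  by apply: ge_sup; [exists (u 0%N - c / 1%:R); exists 0%N | apply: ubE].
by apply/andP; split; move: (c / n.+1%:R) (u n) H1 H2 => *; lra.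
Qed.

(** The factor 2 comes from adding the errors of the real and imaginary parts. *)
Lemma complex_limit_rate (u : nat -> R[i]) (c : R) :
  (forall n m, (n <= m)%N -> `|u m - u n| <= (c / n.+1%:R)%:C) ->
  exists l, forall n, `|u n - l| <= (2 * c / n.+1%:R)%:C.
Proof.
move=> cau.
have [a Ha] : exists l, forall n, `|complex.Re (u n) - l| <= c / n.+1%:R.
  apply: real_limit_rate => n m nm; rewrite -lecR; apply: le_trans (cau _ _ nm).
  by have := normc_ge_Re (u m - u n); case: (u m) (u n) => [? ?] [? ?].
have [b Hb] : exists l, forall n, `|complex.Im (u n) - l| <= c / n.+1%:R.
  apply: real_limit_rate => n m nm; rewrite -lecR; apply: le_trans (cau _ _ nm).
  have := normc_ge_Re (- 'i%C * (u m - u n)); rewrite normrM normrN.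
  have -> : `|'i%C : R[i]| = 1 by rewrite normc_def /= expr0n /= expr1n add0r sqrtr1.
  rewrite mul1r.
  suff -> : complex.Re (- 'i%C * (u m - u n)) = complex.Im (u m) - complex.Im (u n) by [].
  by case: (u m) (u n) => [? ?] [? ?] /=; ring.
exists (a +i* b) => n.
have -> : u n - (a +i* b) = (complex.Re (u n) - a)%:C + 'i%C * (complex.Im (u n) - b)%:C.
  case: (u n) => [x y] /=; apply/eqP; rewrite eq_complex /=.
  by apply/andP; split; apply/eqP; ring.
apply: le_trans (ler_normD _ _) _; rewrite normrM.
have -> : `|'i%C : R[i]| = 1 by rewrite normc_def /= expr0n /= expr1n add0r sqrtr1.
rewrite mul1r -mulrA mulr_natl mulr2n.
have nr (x : R) : `|x%:C| = `|x|%:C by rewrite normc_def /= expr0n /= addr0 sqrtr_sqr.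
by rewrite !nr -rmorphD lecR lerD.
Qed.
End Limits.

(** * Dirichlet characters and their L-values *)

Section Characters.
Local Open Scope ring_scope.
Local Open Scope complex_scope.
Variable R : realType.
Local Notation lnn := (@lnn R).
Local Notation mangoldt := (@mangoldt R).
Implicit Types (chi : nat -> R[i]) (h : nat -> R).

(** The last field says at once that chi vanishes off the units modulo q and takes
its values on the unit circle elsewhere. *)
Record dirichlet_char (q : nat) chi : Prop := DirichletChar {
  dchar1 : chi 1%N = 1;
  dcharM : forall m n, chi (m * n)%N = chi m * chi n;
  dchar_periodic : forall n, chi (n + q)%N = chi n;
  dchar_normE : forall n, `|chi n| = (coprime q n)%:R
}.

Lemma dchar_norm q chi : dirichlet_char q chi -> forall n, `|chi n| <= 1.
Proof. by move=> chiP n; rewrite (dchar_normE chiP) lern1 leq_b1. Qed.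

Definition nonprincipal (q : nat) chi := \sum_(0 <= n < q) chi n = 0.

Definition wsum chi h (N : nat) : R[i] :=
  \sum_(1 <= n < N.+1) chi n * (h n / n%:R)%:C.

Definition lsum chi := wsum chi (fun=> 1).

Lemma norm_realC (x : R) : `|x%:C| = `|x|%:C.
Proof. by rewrite normc_def /= expr0n /= addr0 sqrtr_sqr. Qed.

Lemma norm_sum_le (m M : nat) (F : nat -> R[i]) (G : nat -> R) :
  (forall n, (m <= n < M)%N -> `|F n| <= (G n)%:C) ->
  `|\sum_(m <= n < M) F n| <= (\sum_(m <= n < M) G n)%:C.
Proof.
move=> FG; apply: le_trans (ler_norm_sum _ _ _) _.
by rewrite rmorph_sum; apply: ler_sum_nat.
Qed.

(** Multiplicativity splits chi n / n along every factorisation n = d * m. *)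
Lemma wsum_convolution (chi : nat -> R[i]) h (N : nat) :
  (forall m n, chi (m * n)%N = chi m * chi n) ->
  \sum_(1 <= d < N.+1) chi d * (h d / d%:R)%:C * lsum chi (N %/ d) =
  wsum chi (fun n => \sum_(1 <= d < n.+1 | (d %| n)%N) h d) N.
Proof.
move=> chiM.
transitivity (\sum_(1 <= d < N.+1) \sum_(1 <= m < (N %/ d).+1)
    chi (d * m)%N * (h d / (d * m)%:R)%:C).
  apply: eq_bigr => d _; rewrite /lsum /wsum big_distrr /=.
  apply: eq_bigr => m _; rewrite chiM mulrACA -rmorphM /=.
  by rewrite mul1r natrM invfM mulrA.
rewrite -(sum_over_divisor_pairs N
  (fun d m => chi (d * m)%N * (h d / (d * m)%:R)%:C)).
apply: eq_big_nat => n /andP[n1 _].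
rewrite big_distrl /= rmorph_sum big_distrr /=.
by apply: eq_bigr => d dn; rewrite mulnC divnK.
Qed.

(** Since N <= d * (N %/ d + 1), the error c / (N %/ d + 1), divided by d, is at
most c / N. *)
Lemma wsum_approx (chi : nat -> R[i]) h (N : nat) (L : R[i]) (c : R) :
  (0 < N)%N -> (forall n, `|chi n| <= 1) ->
  (forall n, `|lsum chi n - L| <= (c / n.+1%:R)%:C) ->
  `|\sum_(1 <= d < N.+1) chi d * (h d / d%:R)%:C * (lsum chi (N %/ d) - L)|
  <= (c / N%:R * \sum_(1 <= d < N.+1) `|h d|)%:C.
Proof.
move=> N0 chi1 app.
have c0 : 0 <= c.
  by have := le_trans (normr_ge0 _) (app 0%N); rewrite ler0c divr1.
rewrite big_distrr /=; apply: norm_sum_le => d /andP[d1 _].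
rewrite !normrM norm_realC -[leLHS]mulrA; apply: le_trans (ler_piMl _ (chi1 d)) _.
  by rewrite mulr_ge0 // ler0c.
apply: le_trans (ler_wpM2l _ (app _)) _; first by rewrite ler0c.
rewrite -rmorphM lecR normrM normfV normr_nat mulrC -!mulrA ler_wpM2l //.
rewrite mulrCA [leRHS]mulrC ler_wpM2l // -invfM lef_pV2 ?posrE ?mulr_gt0 ?ltr0n //.
by rewrite -natrM ler_nat ltnW // ltn_ceil.
Qed.

Section LValue.
Variables (q : nat) (chi : nat -> R[i]).
Hypotheses (q0 : (0 < q)%N) (chiP : dirichlet_char q chi).
Hypothesis chi0 : nonprincipal q chi.

Lemma char_sum_bound m M : `|\sum_(m <= n < M) chi n| <= (q%:R : R)%:C.
Proof.
rewrite rmorph_nat.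
exact: (periodic_sum_bound q0 (dchar_periodic chiP) chi0 (dchar_norm chiP)).
Qed.

Lemma lsum_cauchy n m : (n <= m)%N ->
  `|lsum chi m - lsum chi n| <= (q%:R / n.+1%:R)%:C.
Proof.
move=> nm; rewrite /lsum /wsum (@big_cat_nat _ _ _ n.+1) //= addrAC subrr add0r.
apply: le_trans (abel_bound (B := (q%:R : R)%:C) _ _ _ _) _.
- by move=> j; apply: char_sum_bound.
- by move=> k _; rewrite ler0c divr_ge0.
- move=> k nk; rewrite lecR ler_wpM2l // lef_pV2 ?posrE ?ltr0n ?ler_nat //.
  exact: leq_trans nk.
- by rewrite -rmorphM lecR mul1r.
Qed.

Lemma lsum_limit : exists L, forall n,
  `|lsum chi n - L| <= (2 * q%:R / n.+1%:R)%:C.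
Proof. exact: complex_limit_rate lsum_cauchy. Qed.

(** The function ln n / n increases at first, but (ln n + 1) / n decreases from 1
on; the difference of the two is covered by [lsum_cauchy]. *)
Lemma wsum_lnn_bound N : `|wsum chi lnn N| <= (2 * q%:R)%:C.
Proof.
have -> : wsum chi lnn N = wsum chi (fun n => lnn n + 1) N - lsum chi N.
  rewrite /lsum /wsum -sumrB; apply: eq_bigr => n _.
  by rewrite -mulrBr -rmorphB -mulrBl addrK.
apply: le_trans (ler_normB _ _) _.
rewrite mulr_natl mulr2n rmorphD; apply: lerD.
- apply: le_trans (abel_bound (B := (q%:R : R)%:C) _ _ _ _) _.
  + by move=> j; apply: char_sum_bound.
  + by move=> k _; rewrite ler0c divr_ge0 // addr_ge0 // lnn_ge0.
  + move=> k k1; rewrite lecR ler_pdivrMr ?ltr0n // mulrAC ler_pdivlMr ?ltr0n //.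
    have := @lnn_step R k k1; rewrite -(ler_pM2l (_ : 0 < k%:R)) ?ltr0n //.
    rewrite divff ?pnatr_eq0 -?lt0n // -(natr1 k); have := lnn_ge0 R k.
    move: (lnn k.+1) (lnn k) (k%:R) => a b c; nra.
  + by rewrite -rmorphM lecR lnn1 add0r divr1 mulr1.
- have := @lsum_cauchy 0 N (leq0n _).
  by rewrite {2}/lsum /wsum big_geq // subr0 divr1.
Qed.

(** Expanding ln as a divisor sum of mangoldt, [wsum_convolution] expresses the
bounded sum of chi n * ln n / n through the values lsum (N %/ d).  Replacing
these by their limit L turns it into L times the sum of interest, and the
error is controlled by psi N / N. *)
Lemma wsum_mangoldt_bounded (L : R[i]) (c : R) :
  (forall n, `|lsum chi n - L| <= (c / n.+1%:R)%:C) -> L != 0 ->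
  exists B : R, forall N, `|wsum chi mangoldt N| <= B%:C.
Proof.
move=> app Lneq0.
have L0 : 0 < `|L| by rewrite normr_gt0.
have [l lE] : exists l : R, `|L| = l%:C by rewrite normc_def; eexists.
have l0 : 0 < l by rewrite -ltcR -lE.
have c0 : 0 <= c.
  by have := le_trans (normr_ge0 _) (app 0%N); rewrite ler0c divr1.
exists ((2 * q%:R + 4 * c) / l) => N.
case: N => [|N].
  by rewrite /wsum big_geq // normr0 ler0c divr_ge0 ?(ltW l0) // addr_ge0 // mulr_ge0.
have divl (x : R) : (x / l)%:C = x%:C / `|L| by rewrite lE fmorph_div.
rewrite divl ler_pdivlMr ?normr_gt0 // -normrM.
have -> : wsum chi mangoldt N.+1 * L = wsum chi lnn N.+1
   - \sum_(1 <= d < N.+2)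
       chi d * (mangoldt d / d%:R)%:C * (lsum chi (N.+1 %/ d) - L).
  have -> : wsum chi lnn N.+1 =
      wsum chi (fun n => \sum_(1 <= d < n.+1 | (d %| n)%N) mangoldt d) N.+1.
    by apply: eq_big_nat => n /andP[n1 _]; rewrite sum_mangoldt.
  rewrite -wsum_convolution; last exact: dcharM chiP.
  rewrite -sumrB big_distrl /=; apply: eq_bigr => d _; ring.
apply: le_trans (ler_normB _ _) _; rewrite rmorphD; apply: lerD (wsum_lnn_bound _) _.
apply: le_trans (wsum_approx _ (ltn0Sn N) (dchar_norm chiP) app) _.
rewrite lecR (eq_bigr mangoldt); last by move=> d _; rewrite ger0_norm // mangoldt_ge0.
rewrite mulrAC ler_pdivrMr ?ltr0n // -mulrA mulrCA ler_wpM2l //.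
exact: psi_le.
Qed.

(** The same argument for the function h d = mobius d * ln (N / d), whose divisor
sum at n is mangoldt n, plus ln N when n = 1.  Now the limit of lsum is 0, and
the error is controlled by the sum of ln (N / d) over d <= N, that is by
N ln N - ln N! <= N. *)
Lemma wsum_mangoldt_zero (c : R) :
  (forall n, `|lsum chi n| <= (c / n.+1%:R)%:C) ->
  forall N, (0 < N)%N -> `|wsum chi mangoldt N + (lnn N)%:C| <= c%:C.
Proof.
move=> app N N0.
have c0 : 0 <= c.
  by have := le_trans (normr_ge0 _) (app 0%N); rewrite ler0c divr1.
(* ln (N / d) is written lnn N - lnn d. *)
pose h d := (mobius d)%:~R * (lnn N - lnn d).
have -> : wsum chi mangoldt N + (lnn N)%:C =
    \sum_(1 <= d < N.+1) chi d * (h d / d%:R)%:C * (lsum chi (N %/ d) - 0).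
  under eq_bigr do rewrite subr0.
  rewrite wsum_convolution; last exact: dcharM chiP.
  transitivity (wsum chi (fun n => mangoldt n + (n == 1%N)%:R * lnn N) N).
    rewrite /wsum; under [RHS]eq_bigr do rewrite mulrDl rmorphD mulrDr.
    rewrite big_split /=; congr (_ + _).
    rewrite big_ltn // big_nat_cond big1 ?addr0.
      by rewrite (dchar1 chiP) divr1 !mul1r.
    by case=> [|[|n]] //= _; rewrite mul0r mul0r mulr0.
  apply: eq_big_nat => n /andP[n1 _]; congr (_ * (_ / _)%:C).
  rewrite /h; under eq_bigr do rewrite mulrBr.
  rewrite big_split /= sumrN sum_mobius_lnn // opprK -big_distrl /= addrC.
  by rewrite -rmorph_sum sum_mobius // rmorph_nat.
have app0 n : `|lsum chi n - 0| <= (c / n.+1%:R)%:C by rewrite subr0.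
apply: le_trans (wsum_approx _ N0 (dchar_norm chiP) app0) _.
rewrite lecR mulrAC ler_pdivrMr ?ltr0n // ler_wpM2l //.
apply: (@le_trans _ _ (\sum_(1 <= d < N.+1) (lnn N - lnn d))).
  apply: ler_sum_nat => d /andP[d1 dN].
  rewrite /h normrM (@ger0_norm _ (_ - _)) ?subr_ge0 ?ler_lnn //.
  by rewrite ler_piMl ?subr_ge0 ?ler_lnn // -intr_norm lerz1 norm_mobius.
rewrite sumrB -lnn_fact sumr_const_nat subn1 /= -[X in X - _]mulr_natl.
have := lnn_fact_ge R N; lra.
Qed.

End LValue.
End Characters.

(** * The group of characters modulo q *)

Section RootsOfUnity.
Local Open Scope ring_scope.

Lemma prim_root_exists (F : numClosedFieldType) (n : nat) : (0 < n)%N ->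
  exists z : F, n.-primitive_root z.
Proof.
move=> n0; have [r] := closed_field_poly_normal ('X^n - 1 : {poly F}).
rewrite (monicP _) ?monicXnsubC // scale1r => Dp.
have rn1 : all n.-unity_root r by apply/allP=> z; rewrite -root_prod_XsubC -Dp.
have sz_r : (n < (size r).+1)%N.
  by rewrite -(size_prod_XsubC r id) -Dp size_XnsubC.
have [|z] := hasP (has_prim_root n0 rn1 _ sz_r); last by exists z.
by rewrite -separable_prod_XsubC -Dp separable_Xn_sub_1 // pnatr_eq0 -lt0n.
Qed.

End RootsOfUnity.

Section CharacterFamily.
Local Open Scope ring_scope.
Local Open Scope complex_scope.
Variables (q n : nat).
Hypotheses (q1 : (1 < q)%N) (n1 : (1 < n)%N).
Implicit Types (phi psi : {ffun 'Z_q -> 'Z_n}) (x y : 'Z_q).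

(** A character modulo q with values in the n-th roots of unity is given by its
exponents, that is by a homomorphism from the units modulo q to the integers
modulo n.  Extending it by 0 off the units makes this encoding faithful, so
that the characters form a finite subgroup of the finite functions. *)
Definition exponent_map phi :=
  [forall x, forall y, (x \is a GRing.unit) && (y \is a GRing.unit) ==>
     (phi (x * y) == phi x + phi y)]
  && [forall x, (x \isn't a GRing.unit) ==> (phi x == 0)].

Lemma exponent_mapP phi : reflect
  ((forall x y, x \is a GRing.unit -> y \is a GRing.unit ->
      phi (x * y) = phi x + phi y) /\
   (forall x, x \isn't a GRing.unit -> phi x = 0)) (exponent_map phi).
Proof.
apply: (iffP andP) => [[/forallP H1 /forallP H2]|[H1 H2]]; split.
- move=> x y xu yu; have /forallP/(_ y)/implyP := H1 x.
  by rewrite xu yu => /(_ isT)/eqP.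
- by move=> x xu; have /implyP/(_ xu)/eqP := H2 x.
- apply/forallP => x; apply/forallP => y; apply/implyP => /andP[xu yu].
  by rewrite H1.
- by apply/forallP => x; apply/implyP => xu; rewrite H2.
Qed.

Lemma exponent_map0 : exponent_map 0.
Proof. by apply/exponent_mapP; split=> [x y _ _|x _]; rewrite !ffunE ?addr0. Qed.

Lemma exponent_mapD phi psi :
  exponent_map phi -> exponent_map psi -> exponent_map (phi + psi).
Proof.
move=> /exponent_mapP[p1 p2] /exponent_mapP[r1 r2]; apply/exponent_mapP.
split=> [x y xu yu|x xu]; rewrite !ffunE; last by rewrite p2 // r2 // addr0.
by rewrite p1 // r1 // addrACA.
Qed.

Lemma exponent_mapN phi : exponent_map phi -> exponent_map (- phi).
Proof.
move=> /exponent_mapP[p1 p2]; apply/exponent_mapP.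
split=> [x y xu yu|x xu]; rewrite !ffunE; last by rewrite p2 // oppr0.
by rewrite p1 // opprD.
Qed.

Lemma exponent_map_1 phi : exponent_map phi -> phi 1 = 0.
Proof.
move=> /exponent_mapP[p1 _]; have := p1 1 1 (unitr1 _) (unitr1 _).
by rewrite mulr1 => /eqP; rewrite -subr_eq0 opprD addrA subrr sub0r oppr_eq0 => /eqP.
Qed.

(** The irreducible characters of the abelian group of units are linear, and the
intersection of their kernels is trivial.  Their values are algebraic roots of
unity of order dividing totient q, hence n: their exponents with respect to a
fixed primitive root are the required map. *)
Lemma exponent_map_separates (k : nat) : (totient q %| n)%N ->
  coprime q k -> k != 1 %[mod q] ->
  exists2 phi, exponent_map phi & phi k%:R != 0.
Proof.
move=> qn kq k1; have n0 := ltnW n1.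
have [z zP] := C_prim_root_exists n0.
have ku : (k%:R : 'Z_q) \is a GRing.unit by rewrite unitZpE.
pose G := [set: {unit 'Z_q}]%G.
have abG : abelian G by have := units_Zp_abelian q.
have g1 : (FinRing.unit 'Z_q ku) != 1%g.
  apply: contra k1 => /eqP/(congr1 val) /= kE.
  have /(congr1 (@nat_of_ord _)) : (k%:R : 'Z_q) = 1%:R by rewrite kE.
  by rewrite !val_Zp_nat // => ->.
have [i gi] : exists i : Iirr G, FinRing.unit 'Z_q ku \notin cfker ('chi_i)%R.
  apply/existsP; rewrite -negb_forall; apply: contra g1 => /forallP H.
  have : FinRing.unit 'Z_q ku \in \bigcap_(i : Iirr G) cfker ('chi_i)%R.
    by apply/bigcapP => i _; apply: H.
  by rewrite TI_cfker_irr inE.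
have lin : ('chi_i)%R \is a linear_char by move/char_abelianP: abG; apply.
have root u : ('chi[G]_i u) ^+ n = 1.
  have := lin_char_unity_root lin (in_setT u).
  have : (#[u]%g %| n)%N.
    by apply: dvdn_trans qn; rewrite -card_units_Zp ?(ltnW q1) // order_dvdG ?inE.
  by move=> /dvdnP[m ->] H; rewrite mulnC exprM H expr1n.
have [e eP] : exists e : {unit 'Z_q} -> 'Z_n, forall u, 'chi[G]_i u = z ^+ (e u : nat).
  exists (fun u => inZp (sval (prim_rootP zP (root u)))) => u /=.
  rewrite [X in (_ %% X)%N](Zp_cast n1) (prim_expr_mod zP).
  exact: svalP (prim_rootP zP (root u)).
pose phi : {ffun 'Z_q -> 'Z_n} := [ffun x => if insub x is Some u then e u else 0].
have phiE x (xu : x \is a GRing.unit) : phi x = e (FinRing.unit 'Z_q xu).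
  rewrite ffunE insubT; congr e; exact: val_inj.
exists phi.
  apply/exponent_mapP; split=> [x y xu yu|x xu]; last by rewrite ffunE insubN.
  have xyu : x * y \is a GRing.unit by rewrite unitrM xu.
  rewrite !phiE; apply/val_inj => /=.
  have -> : FinRing.unit 'Z_q xyu = (FinRing.unit 'Z_q xu * FinRing.unit 'Z_q yu)%g.
    exact: val_inj.
  set u := FinRing.unit _ _; set v := FinRing.unit _ _.
  have := lin_charM lin (in_setT u) (in_setT v).
  rewrite !eP -exprD => /eqP; rewrite (eq_prim_root_expr zP) => /eqP.
  rewrite [in LHS]modn_small; last by rewrite -[X in (_ < X)%N](Zp_cast n1) ltn_ord.
  by move=> ->; rewrite [X in _ = (_ %% X)%N](Zp_cast n1).
rewrite phiE; apply: contra gi => /eqP eg0.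
by rewrite cfkerEirr inE eP eg0 lin_char1 // expr0.
Qed.

Variable R : realType.
Variable w : R[i].
Hypothesis wP : n.-primitive_root w.

Definition zpow (x : 'Z_n) : R[i] := w ^+ (x : nat).

Lemma zpowD (x y : 'Z_n) : zpow (x + y) = zpow x * zpow y.
Proof. by rewrite /zpow /= [X in (_ %% X)%N](Zp_cast n1) (prim_expr_mod wP) exprD. Qed.

Lemma zpow0 : zpow 0 = 1. Proof. by []. Qed.

Lemma zpow_eq1 (x : 'Z_n) : (zpow x == 1) = (x == 0).
Proof.
rewrite /zpow -[1](expr0 w) (eq_prim_root_expr wP) mod0n modn_small //.
by rewrite -[X in (_ < X)%N](Zp_cast n1) ltn_ord.
Qed.

Lemma norm_zpow (x : 'Z_n) : `|zpow x| = 1.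
Proof.
apply/eqP; rewrite /zpow normrX -(@pexpr_eq1 _ _ n) ?exprn_ge0 ?(ltnW n1) //.
by rewrite -exprM mulnC exprM -(normrX n) (prim_expr_order wP) normr1 expr1n.
Qed.

Definition dchar phi (k : nat) : R[i] :=
  if coprime q k then zpow (phi k%:R) else 0.

Lemma Zp_nat_mod (k : nat) : (k %% q)%:R = k%:R :> 'Z_q.
Proof. by apply: val_inj; rewrite /= !val_Zp_nat // modn_mod. Qed.

Lemma dchar_mod phi k : dchar phi (k %% q) = dchar phi k.
Proof. by rewrite /dchar Zp_nat_mod coprime_modr. Qed.

Lemma dchar_mul phi : exponent_map phi ->
  forall k l, dchar phi (k * l) = dchar phi k * dchar phi l.
Proof.
move=> /exponent_mapP[pM _] k l; rewrite /dchar coprimeMr.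
case: (boolP (coprime q k)) => kq; last by rewrite mul0r.
case: (boolP (coprime q l)) => lq; last by rewrite mulr0.
by rewrite natrM pM ?unitZpE // zpowD.
Qed.

Lemma dcharP phi : exponent_map phi -> dirichlet_char q (dchar phi).
Proof.
move=> pP; split.
- by rewrite /dchar coprimen1 exponent_map_1.
- exact: dchar_mul.
- by move=> k; rewrite -dchar_mod modnDr dchar_mod.
- by move=> k; rewrite /dchar; case: ifP => _; rewrite ?norm_zpow ?normr0.
Qed.

Lemma dchar0 k : dchar 0 k = (coprime q k)%:R.
Proof. by rewrite /dchar ffunE zpow0; case: ifP. Qed.

Lemma dcharD phi psi k : dchar (phi + psi) k = dchar phi k * dchar psi k.
Proof. by rewrite /dchar; case: ifP; rewrite ?mulr0 // ffunE zpowD. Qed.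

Lemma dcharN phi k : dchar (- phi) k = (dchar phi k)^*%C.
Proof.
rewrite /dchar; case: ifP => _; last by rewrite rmorph0.
rewrite ffunE; set x := phi _.
have E : zpow x * zpow (- x) = 1 by rewrite -zpowD subrr.
have /eqP := norm_zpow x; rewrite -(@pexpr_eq1 _ _ 2) // sqr_normc => /eqP E2.
have x0 : zpow x != 0 by rewrite -normr_eq0 norm_zpow oner_eq0.
by apply: (mulfI x0); rewrite E E2.
Qed.

(** Multiplication by a unit g permutes the residues and multiplies the sum by the
value at g, which can be chosen different from 1. *)
Lemma nonprincipal_dchar phi : exponent_map phi -> phi != 0 ->
  nonprincipal q (dchar phi).
Proof.
move=> pP p0; have /exponent_mapP[pM pN] := pP.
have [g gu gn] : exists2 g, g \is a GRing.unit & phi g != 0.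
  have [g gn] : exists g, phi g != 0.
    apply/existsP; rewrite -negb_forall; apply: contra p0 => /forallP H.
    by apply/eqP/ffunP => x; rewrite ffunE; apply/eqP.
  by exists g => //; apply: contraR gn => /pN->.
rewrite /nonprincipal -[X in \sum_(_ <= _ < X) _](Zp_cast q1) big_mkord.
set S := \sum_(_ < _) _.
have E : dchar phi (g : nat) * S = S.
  rewrite /S big_distrr [RHS](reindex_inj (mulrI gu)) /=.
  apply: eq_bigr => x _; rewrite -(dchar_mul pP).
  rewrite -dchar_mod; congr (dchar phi _).
  by rewrite /= [X in _ = (_ %% X)%N](Zp_cast q1).
have gE : dchar phi (g : nat) != 1.
  by rewrite /dchar -unitZpE // natr_Zp gu zpow_eq1.
apply/eqP; have /eqP := E; rewrite -subr_eq0 -{2}[S]mul1r -mulrBl mulf_eq0.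
by rewrite subr_eq0 (negbTE gE).
Qed.

(** Orthogonality: multiplication by a character that is not 1 at k permutes the
characters and multiplies the sum by a number different from 1. *)
Lemma sum_dchar k : (totient q %| n)%N ->
  \sum_(phi | exponent_map phi) dchar phi k =
  if k == 1 %[mod q] then #|[pred phi | exponent_map phi]|%:R else 0.
Proof.
move=> qn; case: eqP => [k1|/eqP k1].
  rewrite (eq_bigr (fun=> 1)) ?sumr_const // => phi pP.
  by rewrite -dchar_mod k1 dchar_mod (dchar1 (dcharP pP)).
case: (boolP (coprime q k)) => kq; last first.
  by rewrite big1 // => phi _; rewrite /dchar (negbTE kq).
have [psi sP sk] := exponent_map_separates qn kq k1.
set S := \sum_(_ | _) _.
have E : S * dchar psi k = S.
  rewrite /S big_distrl [RHS](reindex_inj (addIr psi)) /=.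
  apply: eq_big => [phi|phi _]; last by rewrite dcharD.
  apply/idP/idP => pP; first exact: exponent_mapD.
  by rewrite -(addrK psi phi) exponent_mapD // exponent_mapN.
have sE : dchar psi k != 1 by rewrite /dchar kq zpow_eq1.
apply/eqP; have /eqP := E; rewrite -subr_eq0 -{2}[S]mulr1 -mulrBr mulf_eq0.
by rewrite subr_eq0 (negbTE sE) orbF.
Qed.

End CharacterFamily.

(** * Dirichlet's theorem when no real L-value vanishes *)

Section Dirichlet.
Local Open Scope ring_scope.
Local Open Scope complex_scope.
Variable R : realType.
Local Notation lnn := (@lnn R).
Local Notation mangoldt := (@mangoldt R).

Lemma lnn_unbounded (B : R) : exists2 N, (0 < N)%N & B < lnn N.
Proof.
have l2 : 0 < lnn 2 by rewrite ln_gt0 // ltr1n.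
exists (2 ^ Num.bound `|B / lnn 2|)%N; first by rewrite expn_gt0.
rewrite lnnX // -[ltRHS]mulr_natl -ltr_pdivrMr //.
exact: le_lt_trans (ler_norm _) (archi_boundP (normr_ge0 _)).
Qed.

(** Compared with the sum over all n, what is lost are powers of primes dividing q:
the primes themselves are at most q, and the higher powers are covered by
[sum_mangoldt_nonprime]. *)
Lemma principal_wsum (q : nat) (chi : nat -> R[i]) : (0 < q)%N ->
  (forall k, chi k = (coprime q k)%:R) ->
  exists B : R, forall N, (0 < N)%N ->
    `|wsum chi mangoldt N - (lnn N)%:C| <= B%:C.
Proof.
move=> q0 chiE.
pose D := \sum_(1 <= n < q.+1) mangoldt n / n%:R.
have t0 n : 0 <= mangoldt n / n%:R by rewrite divr_ge0 // mangoldt_ge0.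
exists (6 + D) => N N0.
have -> : wsum chi mangoldt N = (\sum_(1 <= n < N.+1 | coprime q n) mangoldt n / n%:R)%:C.
  rewrite big_mkcond rmorph_sum; apply: eq_bigr => n _.
  by rewrite chiE; case: ifP => _; rewrite ?mul1r // mul0r rmorph0.
rewrite -rmorphB norm_realC lecR.
have up := sum_mangoldt_over_le R N0; have low := sum_mangoldt_over_ge R N0.
rewrite (bigID (coprime q)) /= in up low.
have : \sum_(1 <= n < N.+1 | ~~ coprime q n) mangoldt n / n%:R <= 2 + D.
  apply: (@le_trans _ _
      (\sum_(1 <= n < N.+1 | ~~ prime n) mangoldt n / n%:R
       + \sum_(1 <= n < N.+1 | (n < q.+1)%N) mangoldt n / n%:R)).
    rewrite big_mkcond [X in _ <= X + _]big_mkcond.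
    rewrite [X in _ <= _ + X]big_mkcond -big_split /=.
    apply: ler_sum_nat => n /andP[n1 _]; case: ifP => nq; last first.
      by rewrite addr_ge0 //; case: ifP.
    case: (boolP (prime n)) => pn /=; last by rewrite lerDl; case: ifP.
    have nq' : (n <= q)%N.
      by move: nq; rewrite coprime_sym prime_coprime // negbK => /(dvdn_leq q0).
    by rewrite ltnS nq' add0r.
  apply: lerD; first exact: sum_mangoldt_nonprime.
  rewrite /D; case: (leqP N q) => Nq.
    rewrite [leRHS](@big_cat_nat _ _ _ N.+1) //= -[leLHS]addr0; apply: lerD.
      by rewrite [leLHS]big_mkcond; apply: ler_sum => n _; case: ifP.
    exact: sumr_ge0.
  by rewrite -(big_nat_widen 1 q.+1 N.+1 xpredT) // ltnS ltnW.
have : 0 <= \sum_(1 <= n < N.+1 | ~~ coprime q n) mangoldt n / n%:R by apply: sumr_ge0.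
have : 0 <= D by apply: sumr_ge0.
move: (\sum_(_ <= _ < _ | ~~ _) _) up low => y.
move: (\sum_(_ <= _ < _ | _) _) (lnn N) => x l up low D0 y0 yD.
by rewrite ler_norml; lra.
Qed.

Section Family.
Variables (q n : nat) (w : R[i]).
Hypotheses (q1 : (1 < q)%N) (n1 : (1 < n)%N) (qn : (totient q %| n)%N).
Hypothesis wP : n.-primitive_root w.
Hypothesis real_nonvanishing : forall chi L (c : R),
  dirichlet_char q chi ->
  (forall k, (chi k)^*%C = chi k) ->
  (forall N, `|lsum chi N - L| <= (c / N.+1%:R)%:C) -> L != 0.

Local Notation I := {ffun 'Z_q -> 'Z_n}.
Local Notation chi := (@dchar q n R w).

Lemma eq0_of_rate (x : R[i]) (c : R) :
  (forall N, `|x| <= (c / N.+1%:R)%:C) -> x = 0.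
Proof.
have [l lE] : exists l : R, `|x| = l%:C by rewrite normc_def; eexists.
move=> H; apply/eqP; rewrite -normr_eq0 lE.
have l0 : 0 <= l by rewrite -ler0c -lE.
suff -> : l = 0 by rewrite rmorph0.
apply/eqP; rewrite eq_le l0 andbT leNgt; apply/negP => lp.
have := H (Num.bound `|c / l|).
rewrite lE lecR ler_pdivlMr ?ltr0n // mulrC -ler_pdivlMr //.
rewrite leNgt => /negP; apply.
apply: le_lt_trans (ler_norm _) _.
by apply: lt_trans (archi_boundP (normr_ge0 _)) _; rewrite ltr_nat.
Qed.

Definition lvalue_family (L : I -> R[i]) :=
  forall phi, exponent_map phi -> phi != 0 ->
    forall N, `|lsum (chi phi) N - L phi| <= (2 * q%:R / N.+1%:R)%:C.

(** The coefficient of ln N in the asymptotics of the sum of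
chi n * mangoldt n / n. *)
Definition log_coef (L : I -> R[i]) (phi : I) : R[i] :=
  if phi == 0 then 1 else - (L phi == 0)%:R.

Lemma lvalues_exist : exists L, lvalue_family L.
Proof.
apply: (fin_all_exists (P := fun phi l => exponent_map phi -> phi != 0 ->
  forall N, `|lsum (chi phi) N - l| <= (2 * q%:R / N.+1%:R)%:C)) => phi.
case: (boolP (exponent_map phi)) => [pP|_]; last by exists 0.
case: (boolP (phi != 0)) => [p0|_]; last by exists 0.
have c0 := nonprincipal_dchar q1 n1 wP pP p0.
have [L HL] := lsum_limit (ltnW q1) (dcharP q1 n1 wP pP) c0.
by exists L.
Qed.

(** Orthogonality isolates the class of the inverse of b. *)
Lemma sum_class (b N : nat) :
  \sum_(phi : I | exponent_map phi) chi phi b * wsum (chi phi) mangoldt N =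
  (#|[pred phi : I | exponent_map phi]|%:R *
    \sum_(1 <= m < N.+1 | (b * m)%N == 1 %[mod q]) mangoldt m / m%:R)%:C.
Proof.
under eq_bigr do rewrite big_distrr.
rewrite exchange_big /= [X in _ * X]big_mkcond big_distrr rmorph_sum /=.
apply: eq_bigr => m _.
rewrite (eq_bigr (fun phi => chi phi (b * m) * (mangoldt m / m%:R)%:C)); last first.
  by move=> phi pP; rewrite mulrA (dchar_mul q1 n1 wP pP).
rewrite -big_distrl /= (sum_dchar q1 n1 wP _ qn).
case: ifP => _; last by rewrite mul0r mulr0 rmorph0.
by rewrite -(rmorph_nat (real_complex R)) -rmorphM.
Qed.

Lemma wsum_asymptotics (L : I -> R[i]) : lvalue_family L ->
  exists B : R, forall b N, (0 < N)%N ->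
   `|\sum_(phi : I | exponent_map phi) chi phi b * wsum (chi phi) mangoldt N
     - (\sum_(phi : I | exponent_map phi) chi phi b * log_coef L phi)
       * (lnn N)%:C|
    <= B%:C.
Proof.
move=> HL.
have [B HB] : exists B : I -> R, forall phi, exponent_map phi -> forall N, (0 < N)%N ->
   `|wsum (chi phi) mangoldt N - log_coef L phi * (lnn N)%:C| <= (B phi)%:C.
  apply: (fin_all_exists (P := fun phi b => exponent_map phi -> forall N, (0 < N)%N ->
   `|wsum (chi phi) mangoldt N - log_coef L phi * (lnn N)%:C| <= b%:C)) => phi.
  case: (boolP (exponent_map phi)) => [pP|_]; last by exists 0.
  rewrite /log_coef; case: eqP => [p0|/eqP p0].
    have chiE k : chi phi k = (coprime q k)%:R by rewrite p0 dchar0.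
    have [B HB] := principal_wsum (ltnW q1) chiE.
    by exists B => _ N N0; rewrite mul1r; apply: HB.
  have cP := dcharP q1 n1 wP pP; have c0 := nonprincipal_dchar q1 n1 wP pP p0.
  case: eqP => [L0|/eqP L0].
    exists (2 * q%:R) => _ N N0; rewrite mulN1r opprK.
    apply: (wsum_mangoldt_zero cP) => // k.
    by have := HL _ pP p0 k; rewrite L0 subr0.
  have [B HB] := wsum_mangoldt_bounded (ltnW q1) cP c0 (HL _ pP p0) L0.
  by exists B => _ N _; rewrite oppr0 mul0r subr0.
exists (\sum_(phi : I | exponent_map phi) B phi) => b N N0.
rewrite big_distrl -sumrB /= rmorph_sum; apply: le_trans (ler_norm_sum _ _ _) _.
apply: ler_sum => phi pP; rewrite -mulrA -mulrBr normrM.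
apply: le_trans (HB _ pP _ N0); rewrite ler_piMl //.
exact: dchar_norm (dcharP q1 n1 wP pP) b.
Qed.

(** For b = 1 the left-hand side of [wsum_asymptotics] is nonnegative by
[sum_class], while the coefficient of ln N is 1 minus the number of zeros; two
zeros would make it at most -1. *)
Lemma at_most_one_zero (L : I -> R[i]) : lvalue_family L ->
  forall phi psi, exponent_map phi -> phi != 0 -> L phi = 0 ->
    exponent_map psi -> psi != 0 -> L psi = 0 -> phi = psi.
Proof.
move=> HL phi psi pP p0 Lp rP r0 Lr; apply/eqP/negPn/negP => pr.
have [B HB] := wsum_asymptotics HL.
have [N N0 NB] := lnn_unbounded B.
have := HB 1%N N N0; rewrite sum_class.
set X := #|_|; set P := \sum_(_ <= _ < _ | _) _.
have P0 : 0 <= X%:R * P.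
  by rewrite mulr_ge0 //; apply: sumr_ge0 => m _; rewrite divr_ge0 // mangoldt_ge0.
pose e (phi : I) : R := if phi == 0 then 1 else - (L phi == 0)%:R.
have -> : \sum_(phi : I | exponent_map phi) chi phi 1%N * log_coef L phi
   = (\sum_(phi : I | exponent_map phi) e phi)%:C.
  rewrite rmorph_sum; apply: eq_bigr => f fP.
  rewrite (dchar1 (dcharP q1 n1 wP fP)) mul1r /log_coef /e.
  by case: eqP => _; rewrite ?rmorphN ?rmorph_nat ?rmorph1.
have : \sum_(phi : I | exponent_map phi) e phi <= - 1.
  have e0 : e 0 = 1 by rewrite /e eqxx.
  have ep : e phi = -1 by rewrite /e (negbTE p0) Lp eqxx.
  have er : e psi = -1 by rewrite /e (negbTE r0) Lr eqxx.
  rewrite (bigD1 (0 : I)) ?exponent_map0 //= (bigD1 phi) ?pP //=.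
  rewrite (bigD1 psi) ?rP ?r0 //=; last by rewrite eq_sym.
  set s := (X in _ + (_ + (_ + X))).
  have : s <= 0.
    apply: sumr_le0 => i /andP[/andP[/andP[_ i0] _] _]; rewrite /e (negbTE i0).
    by rewrite oppr_le0.
  by rewrite e0 ep er; lra.
rewrite -rmorphM -rmorphB norm_realC lecR ler_norml => E1 /andP[_ E2].
have := lnn_ge0 R N; move: E2; move: (lnn N) NB => l; move: (\sum_(_ | _) _) E1 => s; nra.
Qed.

(** If L vanishes at phi, it vanishes at the conjugate character, whose exponent map
is - phi.  By uniqueness of the zero the character is real. *)
Lemma lvalues_neq0 (L : I -> R[i]) : lvalue_family L ->
  forall phi, exponent_map phi -> phi != 0 -> L phi != 0.
Proof.
move=> HL phi pP p0; apply/eqP => L0.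
have npP := exponent_mapN pP; have np0 : - phi != 0 by rewrite oppr_eq0.
have nL : L (- phi) = 0.
  have : L (- phi) - (L phi)^*%C = 0; last by rewrite L0 rmorph0 subr0.
  apply: (@eq0_of_rate _ (2 * q%:R + 2 * q%:R)) => N.
  have -> : L (- phi) - (L phi)^*%C =
     (lsum (chi phi) N - L phi)^*%C - (lsum (chi (- phi)) N - L (- phi)).
    rewrite rmorphB /=; suff -> : (lsum (chi phi) N)^*%C = lsum (chi (- phi)) N by ring.
    rewrite /lsum /wsum rmorph_sum; apply: eq_bigr => k _.
    by rewrite [LHS]rmorphM [X in _ * X]conjc_real (dcharN n1 wP).
  apply: le_trans (ler_normB _ _) _.
  by rewrite mulrDl [leRHS]rmorphD normcJ; apply: lerD; apply: HL.
have E := at_most_one_zero HL npP np0 nL pP p0 L0.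
suff : L phi != 0 by rewrite L0 eqxx.
apply: (real_nonvanishing (dcharP q1 n1 wP pP) _ (HL _ pP p0)).
by move=> k; rewrite -(dcharN n1 wP) E.
Qed.

(** Only the principal character has a logarithmic term.  Without a prime in the
class, the left-hand side of [sum_class] would stay bounded by
[sum_mangoldt_nonprime], whereas ln N does not. *)
Lemma prime_in_inverse_class (b : nat) : coprime q b ->
  exists2 p, prime p & (b * p = 1 %[mod q])%N.
Proof.
move=> bq; have [L HL] := lvalues_exist; have [B HB] := wsum_asymptotics HL.
pose X := #|[pred phi : I | exponent_map phi]|.
have [N N0 NB] := lnn_unbounded (X%:R * 2 + B).
pose good p := prime p && ((b * p)%N == 1 %[mod q]).
have [/hasP[p pN /andP[pp /eqP pE]]|/hasPn noP] := boolP (has good (index_iota 1 N.+1)).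
  by exists p.
have main_term : \sum_(phi : I | exponent_map phi)
    chi phi b * log_coef L phi = 1.
  rewrite /log_coef (bigD1 (0 : I)) ?exponent_map0 //=.
  rewrite eqxx dchar0 bq mulr1 big1 ?addr0 //.
  move=> phi /andP[pP p0]; rewrite (negbTE p0).
  by rewrite (negbTE (lvalues_neq0 HL pP p0)) oppr0 mulr0.
have := HB b N N0; rewrite sum_class -/X main_term.
rewrite mul1r -rmorphB norm_realC lecR ler_norml => /andP[E _].
set P := \sum_(_ <= _ < _ | _) _ in E.
have PB : P <= 2.
  apply: le_trans (sum_mangoldt_nonprime R N).
  rewrite /P [leLHS]big_mkcond [leRHS]big_mkcond; apply: ler_sum_nat => m mN.
  have mm : 0 <= mangoldt m / m%:R by rewrite divr_ge0 // mangoldt_ge0.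
  case: ifP => mE; last by case: ifP.
  have := noP m; rewrite /good mem_index_iota mN mE andbT => /(_ isT) ->; exact: lexx.
have : X%:R * P <= X%:R * 2 by rewrite ler_wpM2l.
move: E NB; move: (X%:R * P) (X%:R * 2) (lnn N); clear => *; lra.
Qed.

End Family.
End Dirichlet.

(** * Real characters modulo a power of two *)

Section SquaresModPow2.
Local Open Scope ring_scope.

Lemma odd_sqr_mod8 (j : nat) : odd j -> (j * j = 1 %[mod 8])%N.
Proof.
move=> oj; rewrite -modnMml -modnMmr; have : (j %% 8 < 8)%N by rewrite ltn_mod.
have : odd (j %% 8) by rewrite odd_mod.
by move: (j %% 8)%N => [|[|[|[|[|[|[|[|m]]]]]]]].
Qed.

(** Hensel lifting: if the odd number s is a square root of m modulo 2^r with r >= 3,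
but not modulo 2^(r+1), then s + 2^(r-1) is one modulo 2^(r+1), since the
square changes by s 2^r + 2^(2r-2). *)
Lemma square_mod_pow2 (m r : nat) : (m = 1 %[mod 8])%N ->
  exists s, (s * s = m %[mod 2 ^ r])%N.
Proof.
move=> m1.
have pow2Z k : (2 ^ k)%N%:Z = 2 ^+ k by rewrite -natz natrX.
suff [s [_ sE]] : exists s : nat, odd s /\ (2 ^+ r.+3 %| s%:Z * s%:Z - m%:Z)%Z.
  exists s; apply/eqP; rewrite -eqz_nat -!modz_nat eqz_mod_dvd PoszM.
  apply: dvdz_trans sE; rewrite pow2Z.
  by apply/dvdzP; exists (2 ^+ 3); rewrite -exprD.
elim: r => [|r [s [os /dvdzP[t tE]]]].
  by exists 1%N; split=> //; rewrite -eqz_mod_dvd !modz_nat eqz_nat m1.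
have [u [tu|tu]] : exists u : int, t = u * 2 \/ t = u * 2 + 1.
  by exists (t %/ 2)%Z; lia.
  by exists s; split=> //; apply/dvdzP; exists u; rewrite tE tu !exprS; ring.
exists (s + 2 ^ r.+2)%N; split; first by rewrite oddD oddX os.
have [v vE] : exists v : nat, s = v.*2.+1.
  by exists s./2; rewrite -[LHS]odd_double_half os.
apply/dvdzP; exists (u + 1 + v%:Z + 2 ^+ r).
have -> : (s + 2 ^ r.+2)%N%:Z = s%:Z + 2 ^+ r.+2 by rewrite PoszD pow2Z.
have -> : (s%:Z + 2 ^+ r.+2) * (s%:Z + 2 ^+ r.+2) - m%:Z =
   (s%:Z * s%:Z - m%:Z) + 2 * s%:Z * 2 ^+ r.+2 + 2 ^+ r.+2 * 2 ^+ r.+2 by ring.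
have sE : s%:Z = 2 * v%:Z + 1 by lia.
rewrite tE tu {}sE !exprS; move: (2 ^+ r : int) (v%:Z) => x y; ring.
Qed.

End SquaresModPow2.

Section RealNonvanishing.
Local Open Scope ring_scope.
Local Open Scope complex_scope.
Variable R : realType.

(** The reciprocals decrease, which settles all cases but e = f = -1.  That one is
the convexity of the reciprocal, read off from
1 / u - 1 / (u + 2) = 2 / (u (u + 2)). *)
Lemma alternating_block_ge0 (x e f : R) : 0 <= x ->
  (e = 1 \/ e = -1) -> (f = 1 \/ f = -1) ->
  0 <= 1 / (x + 1) + e / (x + 3) + f / (x + 5) + e * f / (x + 7).
Proof.
move=> x0 he hf.
set a := (x + 1)^-1; set b := (x + 3)^-1; set c := (x + 5)^-1; set d := (x + 7)^-1.
have d0 : 0 <= d by rewrite invr_ge0; lra.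
have cd : d <= c by rewrite lef_pV2 ?posrE; lra.
have bc : c <= b by rewrite lef_pV2 ?posrE; lra.
have ab : b <= a by rewrite lef_pV2 ?posrE; lra.
have abE : a - b = 2 * (a * b) by rewrite /a /b; field; rewrite !gt_eqF //; lra.
have cdE : c - d = 2 * (c * d) by rewrite /c /d; field; rewrite !gt_eqF //; lra.
have : c * d <= a * b by apply: ler_pM => //; lra.
case: he => ->; case: hf => -> *; lra.
Qed.

(** On odd numbers a real character is 1 or -1, and it is 1 on squares of odd
numbers, hence on every number that is 1 modulo 8; so its values have
period 8.  Each block of eight terms of its series is nonnegative and the
first one is at least 1 / 2, which keeps the partial sums away from 0. *)
Lemma real_lvalue_neq0 (r : nat) (chi : nat -> R[i]) (L : R[i]) (c : R) :
  dirichlet_char (2 ^ r.+1) chi -> (forall k, (chi k)^*%C = chi k) ->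
  (forall N, `|lsum chi N - L| <= (c / N.+1%:R)%:C) -> L != 0.
Proof.
move=> chiP chiJ app; apply/eqP => L0.
pose f k := complex.Re (chi k).
have fE k : chi k = (f k)%:C.
  have := chiJ k; rewrite /f; case: (chi k) => a b [] /eqP.
  by rewrite eq_sym -subr_eq0 opprK -mulr2n mulrn_eq0 /= => /eqP ->.
have fM k l : f (k * l)%N = f k * f l.
  by apply: (@complexI R); rewrite rmorphM /= -!fE (dcharM chiP).
have f_even k : ~~ odd k -> f k = 0.
  move=> ek; apply: (@complexI R); rewrite -fE; apply/eqP.
  by rewrite -normr_eq0 (dchar_normE chiP) coprime_pexpl // coprime2n (negbTE ek).
have f_odd k : odd k -> f k = 1 \/ f k = -1.
  move=> ok; have := dchar_normE chiP k.
  rewrite fE norm_realC coprime_pexpl // coprime2n ok.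
  move=> /(@complexI R); case: (ger0P (f k)) => _ fk; first by left.
  by right; rewrite -fk opprK.
have f_mod k l : (k = l %[mod 2 ^ r.+1])%N -> f k = f l.
  have per j : f (j %% 2 ^ r.+1)%N = f j.
    rewrite [in RHS](divn_eq j (2 ^ r.+1)) addnC; elim: (j %/ _)%N => [|i ->].
      by rewrite mul0n addn0.
    rewrite mulSn [(2 ^ _ + _)%N]addnC addnA; apply: (@complexI R).
    by rewrite -!fE (dchar_periodic chiP).
  by move=> kl; rewrite -per kl per.
have f1 : f 1%N = 1 by apply: (@complexI R); rewrite -fE (dchar1 chiP).
have f8 k : (k = 1 %[mod 8])%N -> f k = 1.
  move=> k1; have [s sE] := square_mod_pow2 r.+1 k1.
  rewrite -(f_mod _ _ sE) fM.
  have os : odd s.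
    have : odd k by rewrite -(odd_mod k (erefl : odd 8 = false)) k1.
    rewrite -(@odd_mod k (2 ^ r.+1)) ?oddX // -sE odd_mod ?oddX //.
    by rewrite oddM andbb.
  by case: (f_odd _ os) => ->; rewrite ?mulrNN mulr1.
have f_shift k j : f (8 * k + j)%N = f j.
  case: (boolP (odd j)) => oj; last by rewrite !f_even // oddD oddM.
  have ok : odd (8 * k + j) by rewrite oddD oddM.
  have : f (8 * k + j)%N * f j = 1.
    rewrite -fM f8 // mulnDl -!mulnA mulnC -modnDml modnMl add0n.
    exact: odd_sqr_mod8.
  by case: (f_odd _ oj) => ->; case: (f_odd _ ok) => -> //; lra.
have f7 : f 7%N = f 3%N * f 5%N by rewrite -fM -(f_shift 1%N 7%N).
have block k : \sum_(8 * k <= n < 8 * k.+1) f n / n%:R =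
   1 / ((8 * k)%:R + 1) + f 3%N / ((8 * k)%:R + 3)
   + f 5%N / ((8 * k)%:R + 5) + f 3%N * f 5%N / ((8 * k)%:R + 7).
  rewrite mulnS addnC.
  rewrite -{1}[(8 * k)%N]addn0.
  do 8 (rewrite big_ltn ?ltn_add2l // -?addnS).
  rewrite big_geq // !f_shift f1 f7 !(natrD _ (8 * k)).
  rewrite (f_even 0%N) // (f_even 2%N) // (f_even 4%N) // (f_even 6%N) //.
  by rewrite !mul0r !add0r !addr0 !addrA.
have lower K : 1 / 2 <= \sum_(0 <= n < 8 * K.+1) f n / n%:R.
  elim: K => [|K IH].
    have := block 0%N; rewrite muln0 muln1 => ->; rewrite !add0r.
    have [-> | ->] := f_odd 3%N isT; have [-> | ->] := f_odd 5%N isT; lra.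
  rewrite (@big_cat_nat _ _ _ (8 * K.+1)) //=; last by lia.
  have := alternating_block_ge0 (ler0n R (8 * K.+1)) (f_odd 3%N isT) (f_odd 5%N isT).
  by rewrite block; lra.
pose K := Num.bound `|c|.
have := app (8 * K + 7)%N; rewrite L0 subr0.
have -> : lsum chi (8 * K + 7) = (\sum_(0 <= n < 8 * K.+1) f n / n%:R)%:C.
  rewrite /lsum /wsum -addnS mulnS addnC [in RHS]big_ltn //.
  rewrite f_even // mul0r add0r rmorph_sum.
  by apply: eq_bigr => n _; rewrite fE -rmorphM mul1r.
rewrite norm_realC lecR => H.
have := le_trans (lower K) (le_trans (ler_norm _) H).
rewrite ler_pdivlMr ?ltr0n //.
have := le_lt_trans (ler_norm _) (archi_boundP (normr_ge0 c)).
rewrite -/K -addnS natrD natrM; have := ler0n R K; lra.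
Qed.

End RealNonvanishing.

Section OddClasses.
Local Open Scope ring_scope.
Local Open Scope complex_scope.

(** Dirichlet's theorem for the modulus 2^r: [real_lvalue_neq0] supplies the one
input on L-values that [prime_in_inverse_class] asks for. *)
Theorem prime_in_odd_class (r a : nat) : odd a ->
  exists2 p, prime p & (p = a %[mod 2 ^ r])%N.
Proof.
move=> oa; set R := Rdefinitions.R : realType.
(* The exponent r + 1 keeps the modulus above 1, also for r = 0; the order q of
   the roots of unity is a multiple of totient q = 2 ^ r. *)
pose q := (2 ^ r.+1)%N.
have q1 : (1 < q)%N by rewrite -[1%N](expn0 2) ltn_exp2l.
have aq : coprime q a by rewrite coprime_pexpl // coprime2n.
have qn : (totient q %| q)%N.
  by rewrite totient_pfactor // mul1n dvdn_exp2l.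
have [w wP] := prim_root_exists R[i] (ltnW q1).
(* By Euler's theorem this power is an inverse of a modulo q. *)
pose b := (a ^ (totient q).-1)%N.
have bq : coprime q b by rewrite coprimeXr.
have abE : (a * b = 1 %[mod q])%N.
  rewrite -expnS prednK ?totient_gt0 ?(ltnW q1) //.
  by apply: Euler_exp_totient; rewrite coprime_sym.
have nonv chi L (c : R) : dirichlet_char q chi ->
    (forall k, (chi k)^*%C = chi k) ->
    (forall N, `|lsum chi N - L| <= (c / N.+1%:R)%:C) -> L != 0.
  by move=> cP cJ app; apply: (real_lvalue_neq0 cP cJ app).
have [p pp pE] := prime_in_inverse_class q1 q1 qn wP nonv bq.
exists p => //.
have : (p = a %[mod q])%N.
  by rewrite -[p in LHS]mul1n -modnMml -abE modnMml -mulnA -modnMmr pE modnMmr muln1.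
move=> /(congr1 (modn^~ (2 ^ r)%N)); rewrite !modn_dvdm // dvdn_exp2l //.
Qed.

End OddClasses.

(** * Exponential sums of elementary symmetric functions *)

(** In i * C(2^r, i) = 2^r * C(2^r - 1, i - 1), an odd C(2^r, i) would force 2^r to
divide i. *)
Lemma even_bin_pow2 (r i : nat) : 0 < i < 2 ^ r -> ~~ odd 'C(2 ^ r, i).
Proof.
case: i => // i /= ir; apply/negP => oC.
have : 2 ^ r %| i.+1 * 'C(2 ^ r, i.+1) by rewrite -mul_bin_diag dvdn_mulr.
rewrite Gauss_dvdl; last by rewrite coprimeXl // coprime2n.
by move=> /(dvdn_leq (ltn0Sn i)); rewrite leqNgt ir.
Qed.

(** In Vandermonde's convolution for C(j + 2^r, k) all terms but the first are
even. *)
Lemma odd_bin_period (r j k : nat) : k < 2 ^ r ->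
  odd 'C(j + 2 ^ r, k) = odd 'C(j, k).
Proof.
move=> kr; rewrite addnC -binomial.Vandermonde big_ord_recl bin0 mul1n subn0 oddD.
rewrite (big_morph odd oddD (erefl _)) big1 ?addbF // => i _.
rewrite oddM (negbTE (even_bin_pow2 _)) // lift0 /=.
by apply: leq_ltn_trans kr.
Qed.

Lemma le_last_sorted (s : seq nat) : sorted ltn s -> {in s, forall k, k <= last 0 s}.
Proof.
elim/last_ind: s => // s x _ ss k; rewrite last_rcons mem_rcons inE.
case/orP => [/eqP->//|ks].
have : pairwise ltn (rcons s x) by rewrite -sorted_pairwise //; exact: ltn_trans.
by rewrite pairwise_rcons => /andP[/allP/(_ _ ks)/ltnW].
Qed.

Lemma lt_period (ks : seq nat) : sorted ltn ks ->
  {in ks, forall k, k < 2 ^ period_exp ks}.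
Proof.
move=> ss k kks; apply: leq_ltn_trans (le_last_sorted ss kks) _.
by rewrite /period_exp addn1 trunc_log_ltn.
Qed.

Lemma odd_binsum_mod (ks : seq nat) (j : nat) : sorted ltn ks ->
  odd (binsum ks (j %% 2 ^ period_exp ks)) = odd (binsum ks j).
Proof.
move=> ss; set M := 2 ^ _.
have per i : odd (binsum ks (i + M)) = odd (binsum ks i).
  rewrite /binsum !(big_morph odd oddD (erefl _)) big_seq [RHS]big_seq.
  by apply: eq_bigr => k kks; rewrite odd_bin_period // lt_period.
rewrite [in RHS](divn_eq j M) addnC; elim: (j %/ M) => [|m ->].
  by rewrite mul0n addn0.
by rewrite mulSn [M + _]addnC addnA per.
Qed.

(** Modulo p only the terms j = 0 and j = p of the sum remain, and the first one
is 1 because all entries of ks are positive. *)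
Lemma prime_dvd_expsum (p : nat) (ks : seq nat) :
  prime p -> odd p -> all (fun k => 1 <= k) ks ->
  (p%:Z %| expsum p ks)%Z = odd (binsum ks p).
Proof.
move=> pp op pos; have p0 := prime_gt0 pp.
have b0 : binsum ks 0 = 0.
  rewrite /binsum big_seq big1 // => k kks; rewrite bin0n.
  by have := allP pos _ kks; case: k {kks}.
rewrite /expsum big_ord_recl /= b0 bin0 expr0 mul1r.
case: p p0 pp op => // n _ pp op.
rewrite big_ord_recr /= [bump 0 n]/bump /= add1n binn mulr1.
set S := (\sum_(_ < _) _)%R.
have pS : (n.+1%:Z %| S)%Z.
  apply: rpred_sum => i _; apply: dvdz_mull.
  by rewrite dvdzE /= prime_dvd_bin // /bump /= ltnS ltn_ord.
rewrite addrCA rpredDl // -signr_odd.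
case: (odd (binsum ks n.+1)) => /=; first by rewrite expr1 subrr dvdz0.
rewrite expr0 dvdzE /= gtnNdvd //.
by case: n pp op {S pS} => [|[|n]].
Qed.

Theorem theorem6p1 (ks : seq nat)
    (ks_nonempty : ks != [::])
    (ks_pos : all (fun k => 1 <= k) ks)
    (ks_increasing : sorted ltn ks) :
  ((exists p : nat, [/\ prime p, odd p & (p%:Z %| expsum p ks)%Z])
     <-> (exists j : nat, j \in odd_indices ks /\ odd j))
  /\
  (forall p : nat,
     [/\ prime p, odd p & (p%:Z %| expsum p ks)%Z]
     <->
     prime p /\
     (exists j m : nat,
        [/\ j \in odd_indices ks, odd j & p = j + m * 2 ^ period_exp ks])).
Proof.
set r := period_exp ks.
have odd_mod2r n : odd (n %% 2 ^ r) = odd n.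
  by rewrite odd_mod // oddX /r /period_exp addn1.
have progressions p : [/\ prime p, odd p & (p%:Z %| expsum p ks)%Z] <->
    prime p /\ (exists j m : nat, [/\ j \in odd_indices ks, odd j & p = j + m * 2 ^ r]).
  split=> [[pp op]|[pp [j [m [jin oj pE]]]]].
    rewrite prime_dvd_expsum // => ob; split=> //.
    exists (p %% 2 ^ r), (p %/ 2 ^ r); split; last by rewrite addnC -divn_eq.
      by rewrite mem_filter mem_iota add0n ltn_mod expn_gt0 odd_binsum_mod // ob.
    by rewrite odd_mod2r.
  move: jin; rewrite mem_filter mem_iota add0n -/r => /andP[ob /= jr].
  have jE : j = p %% 2 ^ r by rewrite pE addnC modnMDl modn_small.
  have op : odd p by rewrite -odd_mod2r -jE.
  by split=> //; rewrite prime_dvd_expsum // -odd_binsum_mod // -/r -jE.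
split=> //; split=> [[p /progressions[_ [j [m [jin oj _]]]]]|[j [jin oj]]].
  by exists j.
have [p pp pj] := prime_in_odd_class r oj.
exists p; apply/progressions; split=> //; exists j, (p %/ 2 ^ r); split=> //.
move: jin; rewrite mem_filter mem_iota add0n -/r => /andP[_ /= jr].
by rewrite {1}(divn_eq p (2 ^ r)) pj modn_small // addnC.
Qed.
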